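(* Let $S\subset\mathbb{N}$. The following are equivalent: (1) $S$ is a multiplicative subsemigroup of $\mathbb{N}$. (2) $\mathscr{H}^\infty_S$ is a subalgebra of $\mathscr{H}^\infty$. (3) $\mathscr{H}^\infty_S$ is a Banach algebra (with pointwise operations) with the supremum norm $\|\cdot\|_\infty$.
   Context: $\mathbb{N}=\{1,2,3,\dots\}$ and $\mathbb{C}_0=\{s\in\mathbb{C}:\operatorname{Re}(s)>0\}$. $\mathscr{H}^\infty$ is the set of all Dirichlet series $f=\sum_{n=1}^\infty a_n n^{-s}$ ($a_n\in\mathbb{C}$ for all $n\in\mathbb{N}$) that converge at each $s\in\mathbb{C}_0$ and satisfy $\|f\|_\infty:=\sup_{s\in\mathbb{C}_0}|f(s)|<\infty$. With pointwise operations and the norm $\|\cdot\|_\infty$, $\mathscr{H}^\infty$ is a Banach algebra. For $S\subset\mathbb{N}$, $\mathscr{H}^\infty_S$ is the set of all $f=\sum_{n=1}^\infty a_n n^{-s}\in\mathscr{H}^\infty$ such that $a_n=0$ for all $n\in\mathbb{N}\setminus S$. A subset $S$ of $\mathbb{N}$ is a multiplicative subsemigroup of $\mathbb{N}$ if $s_1s_2\in S$ for all $s_1,s_2\in S$. A subalgebra of a complex algebra is a subset closed under the inherited addition, scalar multiplication and multiplication (it is not required to contain the unit). *)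

(* Defs.v *)
From Stdlib Require Import Reals.
From Coquelicot Require Import Coquelicot.

Local Open Scope R_scope.

Definition C0 : Type := {s : C | 0 < Re s}.

Definition Cexp (z : C) : C := (exp (Re z) * cos (Im z), exp (Re z) * sin (Im z)).

(** [n^(-s)] for [n >= 1]. *)
Definition n_pow_opp (n : nat) (s : C) : C := Cexp (- s * RtoC (ln (INR n)))%C.

(** Coefficients are indexed by [n >= 1]; the value [a 0] is never used. *)
Definition is_dirichlet_series (a : nat -> C) (f : C0 -> C) : Prop :=
  forall s : C0,
    @is_series C_AbsRing C_NormedModule
      (fun k : nat => (a (S k) * n_pow_opp (S k) (proj1_sig s))%C) (f s).

Definition sup_norm (f : C0 -> C) : Rbar :=
  Lub_Rbar (fun r : R => exists s : C0, r = Cmod (f s)).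

Definition Hinf (f : C0 -> C) : Prop :=
  (exists a : nat -> C, is_dirichlet_series a f) /\
  Rbar_lt (sup_norm f) p_infty.

(** The coefficients of a Dirichlet series are determined by its sum, so the
    existential below speaks of "the" coefficients of [f]. *)
Definition HinfS (S : nat -> Prop) (f : C0 -> C) : Prop :=
  Hinf f /\
  exists a : nat -> C,
    is_dirichlet_series a f /\
    forall n : nat, (1 <= n)%nat -> ~ S n -> a n = RtoC 0.

Definition fun_plus (f g : C0 -> C) : C0 -> C := fun s => (f s + g s)%C.
Definition fun_scal (c : C) (f : C0 -> C) : C0 -> C := fun s => (c * f s)%C.
Definition fun_mult (f g : C0 -> C) : C0 -> C := fun s => (f s * g s)%C.

Definition multiplicative_subsemigroup (S : nat -> Prop) : Prop :=
  forall m n : nat, S m -> S n -> S (m * n)%nat.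

Definition is_subalgebra (B A : (C0 -> C) -> Prop) : Prop :=
  (forall f, B f -> A f) /\
  (forall f g, B f -> B g -> B (fun_plus f g)) /\
  (forall (c : C) f, B f -> B (fun_scal c f)) /\
  (forall f g, B f -> B g -> B (fun_mult f g)).

(** Complex Banach algebras, not necessarily unital or commutative. *)
Record BanachAlgebra : Type := {
  ba_space :> CompleteNormedModule C_AbsRing;
  ba_mult : ba_space -> ba_space -> ba_space;
  ba_mult_assoc : forall x y z : ba_space,
    ba_mult x (ba_mult y z) = ba_mult (ba_mult x y) z;
  ba_mult_plus_l : forall x y z : ba_space,
    ba_mult (plus x y) z = plus (ba_mult x z) (ba_mult y z);
  ba_mult_plus_r : forall x y z : ba_space,
    ba_mult x (plus y z) = plus (ba_mult x y) (ba_mult x z);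
  ba_mult_scal_l : forall (c : C) (x y : ba_space),
    ba_mult (scal c x) y = scal c (ba_mult x y);
  ba_mult_scal_r : forall (c : C) (x y : ba_space),
    ba_mult x (scal c y) = scal c (ba_mult x y);
  ba_norm_mult : forall x y : ba_space,
    norm (ba_mult x y) <= norm x * norm y
}.

(** The set [H] of functions, with pointwise operations and the supremum norm,
    is a Banach algebra: [iota] identifies the elements of some Banach algebra
    with those of [H], operations and norm included. *)
Definition is_sup_norm_banach_algebra (H : (C0 -> C) -> Prop) : Prop :=
  exists (B : BanachAlgebra) (iota : B -> C0 -> C),
    (forall x y : B, iota x = iota y -> x = y) /\
    (forall f : C0 -> C, H f <-> exists x : B, iota x = f) /\
    (forall x y : B, iota (plus x y) = fun_plus (iota x) (iota y)) /\
    (forall (c : C) (x : B), iota (scal c x) = fun_scal c (iota x)) /\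
    (forall x y : B, iota (ba_mult B x y) = fun_mult (iota x) (iota y)) /\
    (forall x : B, Finite (norm x) = sup_norm (iota x)).

(* Main.v *)
Require Import Defs.
From Stdlib Require Import Reals Lra Lia Psatz Classical ClassicalEpsilon FunctionalExtensionality
  ProofIrrelevance PropExtensionality.
From Coquelicot Require Import Coquelicot.

(** Everything rests on a uniform form of Bohr's theorem: if [|f| <= B] on [C0], the sums
    [S_M f (s)] of its Dirichlet series satisfy [|S_M f (s)| <= (25 + 18 ln (M + 2)) B] for all
    [s] in [C0].  A finite combination [sum_i w_i f (s + i u_i)] of vertical translates is
    bounded by [B sum_i |w_i|], and it multiplies the n-th coefficient by
    [sum_i w_i n^(- i u_i)].  We take for this multiplier the convolution of the indicator of
    [- L, L], [L ~ ln M], with the normalised kernel [cos^(2K)] at scale [d], as a function of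
    [ln n]: its Fourier coefficients have an l1 norm of size [ln M], uniformly in the period
    [PI / d], and its error beyond the cutoff is summable in [n].

    Abel summation then gives [|f (s) - S_M f (s)| <= tau (M) B] on [Re s >= eps], where [tau]
    depends only on [eps] and tends to 0.  So a uniform limit of elements of [H^oo_S] stays in
    [H^oo_S], which is completeness; and [(f g) (. + eps)] is a uniform limit of products of
    partial sums, hence in [H^oo_S] when [S] is multiplicative, for every [eps > 0].
    Conversely, [m^(-s) n^(-s) = (mn)^(-s)] and the coefficients are unique. *)

Local Open Scope R_scope.

(** * Finite complex sums and Abel summation *)

(** The translates act on a partial sum [S_N f] with [N] far beyond [M]: the tail [f - S_N f] is
    controlled only up to a factor linear in the height [u], and letting [N] tend to infinity has to
    beat that factor. The multiplier is periodic in [ln n], and its half period is made to exceed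
    all frequencies up to [ln N], so the number of harmonics grows with [N]. Two facts keep this
    harmless. With [K = r * r] the kernel has width about [1 / (r d)] in [ln n], and the l1 norm
    depends on [r] and [d] only through [r d], which is fixed by [M]. The heights in use grow only
    like [ln N], so the decay of the tail in [N] wins.

    The width is of order [M^(-6)], much finer than the gap of order [1 / M] between consecutive
    frequencies near [ln M]. Since [cos^(2K)] is a trigonometric polynomial with explicit
    nonnegative coefficients, its primitive is explicit too, and the argument runs on finite sums
    and derivatives, without integrals. *)

Definition psum (x : nat -> C) (n : nat) : C := @sum_n C_AbelianMonoid x n.

Lemma psum_0 (x : nat -> C) : psum x 0 = x O.
Proof. exact (@sum_O C_AbelianMonoid x). Qed.

Lemma psum_S (x : nat -> C) (n : nat) : psum x (S n) = (psum x n + x (S n))%C.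
Proof. exact (@sum_Sn C_AbelianMonoid x n). Qed.

Lemma psum_ext (x y : nat -> C) (n : nat) :
  (forall k, (k <= n)%nat -> x k = y k) -> psum x n = psum y n.
Proof. exact (@sum_n_ext_loc C_AbelianMonoid x y n). Qed.

Lemma psum_plus (x y : nat -> C) (n : nat) :
  psum (fun k => x k + y k)%C n = (psum x n + psum y n)%C.
Proof. exact (@sum_n_plus C_AbelianMonoid x y n). Qed.

Lemma psum_scal (c : C) (x : nat -> C) (n : nat) :
  psum (fun k => c * x k)%C n = (c * psum x n)%C.
Proof. exact (@sum_n_mult_l C_Ring c x n). Qed.

Lemma psum_minus (x y : nat -> C) (n : nat) :
  psum (fun k => x k - y k)%C n = (psum x n - psum y n)%C.
Proof.
induction n as [|n IH]; [now rewrite !psum_0|].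
rewrite !psum_S, IH; ring.
Qed.

Lemma psum_zero (x : nat -> C) (n : nat) :
  (forall k, (k <= n)%nat -> x k = RtoC 0) -> psum x n = RtoC 0.
Proof.
induction n as [|n IH]; intros H.
- rewrite psum_0; apply H; lia.
- rewrite psum_S, IH, H by (intros; try apply H; lia); ring.
Qed.

Lemma Cmod_minus_sym (x y : C) : Cmod (x - y) = Cmod (y - x).
Proof. rewrite <- Cmod_opp; f_equal; ring. Qed.

Lemma Cmod_psum_le (x : nat -> C) (y : nat -> R) (n : nat) :
  (forall k, (k <= n)%nat -> Cmod (x k) <= y k) ->
  Cmod (psum x n) <= sum_f_R0 y n.
Proof.
induction n as [|n IH]; intros H; simpl.
- rewrite psum_0; apply H; lia.
- rewrite psum_S; eapply Rle_trans; [apply Cmod_triangle|].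
  apply Rplus_le_compat; [apply IH; intros; apply H; lia|apply H; lia].
Qed.

Lemma is_series_C (x : nat -> C) (l : C) :
  @is_series C_AbsRing C_NormedModule x l <->
  forall e : R, 0 < e -> exists N, forall n, (N <= n)%nat -> Cmod (psum x n - l) < e.
Proof.
split.
- intros H e He.
  destruct (proj1 (filterlim_locally_ball_norm _ _) H (mkposreal e He)) as [N HN].
  exists N; intros n Hn; exact (HN n Hn).
- intros H; apply (proj2 (@filterlim_locally_ball_norm C_AbsRing nat C_NormedModule
    eventually _ (psum x) l)).
  intros e; destruct (H e (cond_pos e)) as [N HN].
  exists N; intros n Hn; exact (HN n Hn).
Qed.

Lemma Cmod_limit_le (x : nat -> C) (l z : C) (r : R) (N : nat) :
  @is_series C_AbsRing C_NormedModule x l ->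
  (forall n, (N <= n)%nat -> Cmod (psum x n - z) <= r) -> Cmod (l - z) <= r.
Proof.
intros Hl Hz; apply le_epsilon; intros e He.
destruct (proj1 (is_series_C x l) Hl e He) as [n0 Hn0].
specialize (Hn0 (max n0 N) (Nat.le_max_l _ _)).
specialize (Hz (max n0 N) (Nat.le_max_r _ _)).
replace (l - z)%C with (- (psum x (max n0 N) - l) + (psum x (max n0 N) - z))%C by ring.
eapply Rle_trans; [apply Cmod_triangle|]; rewrite Cmod_opp; lra.
Qed.

Lemma is_series_C_bounded (x : nat -> C) (l : C) :
  @is_series C_AbsRing C_NormedModule x l ->
  exists A, 0 <= A /\ forall n, Cmod (psum x n) <= A.
Proof.
intros Hl.
destruct (proj1 (is_series_C x l) Hl 1 Rlt_0_1) as [N HN].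
assert (HN' : forall m, exists A, 0 <= A /\ forall n, (n <= m)%nat -> Cmod (psum x n) <= A).
{ induction m as [|m [A [HA IH]]].
  - exists (Cmod (psum x 0)); split; [apply Cmod_ge_0|].
    intros n Hn; replace n with O by lia; lra.
  - exists (Rmax A (Cmod (psum x (S m)))); split.
    + eapply Rle_trans; [exact HA|apply Rmax_l].
    + intros n Hn; destruct (Nat.eq_dec n (S m)) as [->|Hne]; [apply Rmax_r|].
      eapply Rle_trans; [apply IH; lia|apply Rmax_l]. }
destruct (HN' N) as [A [HA HA']].
exists (A + (Cmod l + 1)); split; [pose proof (Cmod_ge_0 l); lra|].
intros n; destruct (Nat.le_ge_cases n N) as [Hn|Hn].
- specialize (HA' n Hn); pose proof (Cmod_ge_0 l); lra.
- specialize (HN n Hn); replace (psum x n) with ((psum x n - l) + l)%C by ring.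
  eapply Rle_trans; [apply Cmod_triangle|]; lra.
Qed.

(** The variation of [w], weighted by the partial sums of [x], enters through a majorant [y] that
    telescopes. The partial sums may therefore grow, provided that the variation of [w] makes up for
    it. *)
Lemma abel_summation (x w : nat -> C) (y : nat -> R) :
  (forall n, Cmod (psum x n) * Cmod (w n - w (S n)) <= y n - y (S n)) ->
  forall N n, (N <= n)%nat ->
  Cmod (psum (fun k => x k * w k)%C n - psum (fun k => x k * w k)%C N) <=
  (y N - y n) + Cmod (psum x n) * Cmod (w n) + Cmod (psum x N) * Cmod (w N).
Proof.
intros Hy N.
(* The partial sum minus its boundary term; passing from [n] to [S n] changes it by
   [psum x n * (w n - w (S n))]. *)
set (U := fun n => (psum (fun k => x k * w k) n - psum x n * w n)%C).
assert (HU : forall n, (N <= n)%nat -> Cmod (U n - U N) <= y N - y n).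
{ induction 1 as [|n Hn IH].
  - replace (U N - U N)%C with (RtoC 0) by ring; rewrite Cmod_0; lra.
  - replace (U (S n) - U N)%C
      with ((U n - U N) + psum x n * (w n - w (S n)))%C.
    + eapply Rle_trans; [apply Cmod_triangle|]; rewrite Cmod_mult.
      specialize (Hy n); lra.
    + unfold U; rewrite !psum_S; ring. }
intros n Hn; specialize (HU n Hn).
match goal with |- Cmod ?z <= _ =>
  replace z with ((U n - U N) + psum x n * w n + - (psum x N * w N))%C
    by (unfold U; ring) end.
rewrite <- !Cmod_mult; rewrite <- (Cmod_opp (psum x N * w N)).
eapply Rle_trans; [apply Cmod_triangle|].
apply Rplus_le_compat_r; eapply Rle_trans; [apply Cmod_triangle|].
lra.
Qed.

(** * Unimodular numbers, the frequencies [ln n], and the polar form of [n^(-s)] *)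

Definition cis (x : R) : C := (cos x, sin x).

Lemma cis_plus (x y : R) : cis (x + y) = (cis x * cis y)%C.
Proof.
unfold cis, Cmult; simpl; rewrite cos_plus, sin_plus; f_equal; ring.
Qed.

Lemma cis_0 : cis 0 = RtoC 1.
Proof. unfold cis; now rewrite cos_0, sin_0. Qed.

Lemma Cmod_cis (x : R) : Cmod (cis x) = 1.
Proof.
unfold Cmod, cis; simpl fst; simpl snd.
replace (cos x ^ 2 + sin x ^ 2) with 1; [apply sqrt_1|].
pose proof (sin2_cos2 x) as H; unfold Rsqr in H; lra.
Qed.

Lemma cis_cos (x : R) : (RtoC (2 * cos x) = cis x + cis (- x))%C.
Proof.
unfold cis, Cplus, RtoC; simpl; rewrite cos_neg, sin_neg; f_equal; ring.
Qed.

(* All sums start at [0]: the index [k] stands for the integer [n = k + 1]. *)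
Definition lam (k : nat) : R := ln (INR (S k)).

Lemma lam_0 : lam 0 = 0.
Proof. unfold lam; simpl; apply ln_1. Qed.

Lemma INR_S_pos (k : nat) : 0 < INR (S k).
Proof. apply lt_0_INR; lia. Qed.

Lemma lam_lt (j k : nat) : (j < k)%nat -> lam j < lam k.
Proof. intros H; apply ln_increasing; [apply INR_S_pos|apply lt_INR; lia]. Qed.

Lemma lam_le (j k : nat) : (j <= k)%nat -> lam j <= lam k.
Proof.
intros H; destruct (Nat.eq_dec j k) as [->|Hn]; [lra|].
apply Rlt_le, lam_lt; lia.
Qed.

Lemma lam_pos (k : nat) : 0 <= lam k.
Proof. rewrite <- lam_0; apply lam_le; lia. Qed.

Lemma exp_lam (k : nat) : exp (lam k) = INR (S k).
Proof. apply exp_ln, INR_S_pos. Qed.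

Lemma n_pow_opp_S (k : nat) (s : C) :
  n_pow_opp (S k) s = (RtoC (exp (- Re s * lam k)) * cis (- Im s * lam k))%C.
Proof.
destruct s as [a b].
unfold n_pow_opp, Cexp, cis, Cmult, Copp, RtoC, Re, Im; fold (lam k); simpl fst; simpl snd.
f_equal; replace (- a * lam k - - b * 0) with (- a * lam k) by ring;
replace (- a * 0 + - b * lam k) with (- b * lam k) by ring; ring.
Qed.

Lemma n_pow_opp_plus (k : nat) (s t : C) :
  n_pow_opp (S k) (s + t) = (n_pow_opp (S k) s * n_pow_opp (S k) t)%C.
Proof.
rewrite !n_pow_opp_S; destruct s as [a b], t as [c d]; simpl Re; simpl Im.
replace (- (a + c) * lam k) with (- a * lam k + - c * lam k) by ring.
replace (- (b + d) * lam k) with (- b * lam k + - d * lam k) by ring.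
rewrite exp_plus, cis_plus, RtoC_mult; ring.
Qed.

Lemma Cmod_n_pow_opp (k : nat) (s : C) :
  Cmod (n_pow_opp (S k) s) = exp (- Re s * lam k).
Proof.
rewrite n_pow_opp_S, Cmod_mult, Cmod_cis, Cmod_R, Rabs_right, Rmult_1_r; [easy|].
apply Rle_ge, Rlt_le, exp_pos.
Qed.

(** * Bounds for the coefficients *)

Lemma psum_delta (j n : nat) (z : C) : (j <= n)%nat ->
  psum (fun k => if Nat.eqb k j then z else RtoC 0) n = z.
Proof.
intros Hj.
assert (H : forall m, (m < j)%nat ->
  psum (fun k => if Nat.eqb k j then z else RtoC 0) m = RtoC 0).
{ intros m Hm; apply psum_zero; intros k Hk.
  destruct (Nat.eqb_spec k j) as [E|_]; [lia|easy]. }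
induction Hj as [|n Hj IH].
- destruct j as [|j]; [now rewrite psum_0|].
  rewrite psum_S, H, Nat.eqb_refl by lia; ring.
- rewrite psum_S, IH.
  destruct (Nat.eqb_spec (S n) j) as [E|_]; [lia|ring].
Qed.

(* Multiplying the coefficients by [cos (d * (lam k - m))] amounts to averaging two
   unimodular multiples of vertical translates, so it does not increase the supremum. *)
Lemma trig_sum_cos_pow (b : nat -> C) (N : nat) (B d m : R) :
  (forall u, Cmod (psum (fun k => b k * cis (u * lam k))%C N) <= B) ->
  forall K u,
  Cmod (psum (fun k => RtoC (cos (d * (lam k - m)) ^ K) * (b k * cis (u * lam k)))%C N) <= B.
Proof.
intros HB; induction K as [|K IH]; intros u.
- erewrite psum_ext; [apply (HB u)|].
  intros k _; simpl; ring.
- set (F := fun u =>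
    psum (fun k => RtoC (cos (d * (lam k - m)) ^ K) * (b k * cis (u * lam k)))%C N).
  replace (psum _ N) with
    (RtoC (/ 2) * (cis (- (d * m)) * F (u + d)%R + cis (d * m) * F (u - d)%R))%C.
  + rewrite Cmod_mult, Cmod_R, Rabs_right by lra.
    pose proof (Cmod_triangle (cis (- (d * m)) * F (u + d)%R) (cis (d * m) * F (u - d)%R)) as H.
    rewrite !Cmod_mult, !Cmod_cis in H.
    pose proof (IH (u + d)) as H1; pose proof (IH (u - d)) as H2.
    fold (F (u + d)) in H1; fold (F (u - d)) in H2; lra.
  + unfold F; rewrite <- !psum_scal, <- psum_plus, <- psum_scal.
    apply psum_ext; intros k _; simpl pow.
    replace (cos (d * (lam k - m))) with (/ 2 * (2 * cos (d * (lam k - m)))) at 3 by field.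
    rewrite !RtoC_mult, <- RtoC_mult with (x := 2), cis_cos.
    replace ((u + d) * lam k) with (u * lam k + d * lam k) by ring.
    replace ((u - d) * lam k) with (u * lam k + - (d * lam k)) by ring.
    replace (d * (lam k - m)) with (d * lam k + - (d * m)) at 3 by ring.
    replace (- (d * (lam k - m))) with (d * m + - (d * lam k)) by ring.
    rewrite !cis_plus; ring.
Qed.

Lemma is_lim_seq_sum_f_R0_0 (g : nat -> nat -> R) (N : nat) :
  (forall k, (k <= N)%nat -> is_lim_seq (g k) 0) ->
  is_lim_seq (fun K => sum_f_R0 (fun k => g k K) N) 0.
Proof.
induction N as [|N IH]; intros H; simpl; [apply H; lia|].
replace (Finite 0) with (Rbar_plus 0 0) by (simpl; f_equal; ring).
apply is_lim_seq_plus'; [apply IH; intros; apply H; lia|apply H; lia].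
Qed.

Lemma Rabs_cos_lt_1 (x : R) : 0 < Rabs x < PI -> Rabs (cos x) < 1.
Proof.
intros Hx.
assert (H : cos x = cos (Rabs x)).
{ unfold Rabs; destruct (Rcase_abs x); [now rewrite cos_neg|easy]. }
rewrite H; apply Rabs_def1.
- rewrite <- cos_0; apply cos_decreasing_1; lra.
- replace (- (1)) with (cos PI) by (rewrite cos_PI; ring); apply cos_decreasing_1; lra.
Qed.

(** Multiplying by [cos (d * (lam k - lam j)) ^ K] keeps the bound [B] and leaves [b j] alone. As
    [K] tends to infinity all other terms die, since their cosines have absolute value below 1. *)
Lemma trig_sum_coef_bound (b : nat -> C) (N : nat) (B : R) :
  (forall u, Cmod (psum (fun k => b k * cis (u * lam k))%C N) <= B) ->
  forall j, (j <= N)%nat -> Cmod (b j) <= B.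
Proof.
intros HB j Hj.
(* Makes [d * (lam k - lam j)] smaller than 1 in absolute value, so it is nonzero and away from [PI]
   for [k <> j]. *)
set (d := / (1 + lam N)).
assert (HN := lam_pos N).
assert (Hd : 0 < d) by (apply Rinv_0_lt_compat; lra).
assert (Hd1 : d * lam N < 1).
{ unfold d; apply Rmult_lt_reg_l with (1 + lam N); [lra|].
  rewrite <- Rmult_assoc, Rinv_r by lra; lra. }
set (c := fun k => cos (d * (lam k - lam j))).
set (g := fun k K => if Nat.eqb k j then 0 else Rabs (c k) ^ K * Cmod (b k)).
assert (Hlim : is_lim_seq (fun K => sum_f_R0 (fun k => g k K) N) 0).
{ apply is_lim_seq_sum_f_R0_0; intros k Hk; unfold g.
  destruct (Nat.eqb_spec k j) as [E|Hkj]; [apply is_lim_seq_const|].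
  replace (Finite 0) with (Rbar_mult 0 (Cmod (b k))) by (simpl; f_equal; ring).
  apply is_lim_seq_mult'; [|apply is_lim_seq_const].
  apply is_lim_seq_geom; rewrite Rabs_Rabsolu; apply Rabs_cos_lt_1.
  rewrite Rabs_mult, (Rabs_right d) by lra.
  pose proof (lam_le k N Hk); pose proof (lam_le j N Hj).
  pose proof (lam_pos k); pose proof (lam_pos j).
  assert (Hne : lam k - lam j <> 0).
  { destruct (Nat.lt_total k j) as [h|[h|h]]; [|lia|]; apply lam_lt in h; lra. }
  split.
  - apply Rmult_lt_0_compat; [easy|now apply Rabs_pos_lt].
  - pose proof PI2_1; apply Rle_lt_trans with (d * lam N); [|lra].
    apply Rmult_le_compat_l; [lra|apply Rabs_le; lra]. }
assert (Hle : forall K, Cmod (b j) <= B + sum_f_R0 (fun k => g k K) N).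
{ intros K.
  pose proof (trig_sum_cos_pow b N B d (lam j) HB K 0) as H1.
  rewrite <- (psum_delta j N (b j) Hj) at 1.
  set (z := fun k => (RtoC (cos (d * (lam k - lam j)) ^ K) * (b k * cis (0 * lam k)))%C) in H1.
  set (D := fun k => if Nat.eqb k j then b j else RtoC 0).
  replace (psum D N) with (psum z N - psum (fun k => z k - D k)%C N)%C
    by (rewrite psum_minus; ring).
  eapply Rle_trans; [apply Cmod_triangle|]; rewrite Cmod_opp.
  apply Rplus_le_compat; [exact H1|].
  apply Cmod_psum_le; intros k _; unfold z, D, g, c.
  rewrite Rmult_0_l, cis_0.
  destruct (Nat.eqb_spec k j) as [->|_].
  - rewrite Rminus_diag, Rmult_0_r, cos_0, pow1.
    replace (1 * (b j * 1) - b j)%C with (RtoC 0) by ring.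
    rewrite Cmod_0; lra.
  - replace (RtoC (cos (d * (lam k - lam j)) ^ K) * (b k * 1) - 0)%C
      with (RtoC (cos (d * (lam k - lam j)) ^ K) * b k)%C by ring.
    rewrite Cmod_mult, Cmod_R, RPow_abs; lra. }
assert (Hl2 : is_lim_seq (fun K => B + sum_f_R0 (fun k => g k K) N) B).
{ replace (Finite B) with (Rbar_plus B 0) by (simpl; f_equal; ring).
  apply is_lim_seq_plus'; [apply is_lim_seq_const|exact Hlim]. }
exact (is_lim_seq_le _ _ (Finite (Cmod (b j))) B Hle (is_lim_seq_const _) Hl2).
Qed.

Definition dterm (a : nat -> C) (s : C) (k : nat) : C := (a (S k) * n_pow_opp (S k) s)%C.

Lemma dterm_plus (a : nat -> C) (s t : C) (k : nat) :
  dterm a (s + t) k = (dterm a s k * n_pow_opp (S k) t)%C.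
Proof. unfold dterm; rewrite n_pow_opp_plus; ring. Qed.

Lemma dterm_bounded (a : nat -> C) (s : C) (l : C) :
  @is_series C_AbsRing C_NormedModule (dterm a s) l ->
  exists A, 0 <= A /\ forall k, Cmod (dterm a s k) <= A.
Proof.
intros Hl; destruct (is_series_C_bounded _ _ Hl) as [A [HA H]].
exists (A + A); split; [lra|]; intros [|k].
- rewrite <- psum_0; specialize (H O); lra.
- replace (dterm a s (S k)) with (psum (dterm a s) (S k) - psum (dterm a s) k)%C
    by (rewrite psum_S; ring).
  eapply Rle_trans; [apply Cmod_triangle|]; rewrite Cmod_opp.
  pose proof (H k); pose proof (H (S k)); lra.
Qed.

Lemma telescoping_tail (x : nat -> C) (y : nat -> R) :
  (forall n, Cmod (x (S n)) <= y n - y (S n)) -> (forall n, 0 <= y n) ->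
  forall N n, (N <= n)%nat -> Cmod (psum x n - psum x N) <= y N.
Proof.
intros H Hy N n Hn.
assert (H' : Cmod (psum x n - psum x N) <= y N - y n).
{ induction Hn as [|n Hn IH].
  - replace (psum x N - psum x N)%C with (RtoC 0) by ring; rewrite Cmod_0; lra.
  - rewrite psum_S.
    replace (psum x n + x (S n) - psum x N)%C with (psum x n - psum x N + x (S n))%C by ring.
    eapply Rle_trans; [apply Cmod_triangle|]; specialize (H n); lra. }
specialize (Hy n); lra.
Qed.

Definition bounded_by (B : R) (f : C0 -> C) : Prop := forall s, Cmod (f s) <= B.

(** Convergence at [s = 1] bounds the terms on the line [Re s = 3] by [A / n^2], whatever the
    height, so the partial sums there are at most [B + A / (N + 1)]. Apply [trig_sum_coef_bound] to
    the coefficients [a_n n^(-3)] and let [N] tend to infinity. The cubic loss is affordable because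
    the cutoff error will decay like a fifth power. *)
Lemma dirichlet_coef_bound (a : nat -> C) (f : C0 -> C) (B : R) :
  is_dirichlet_series a f -> bounded_by B f ->
  forall k, Cmod (a (S k)) <= INR (S k) ^ 3 * B.
Proof.
intros Ha HB j.
assert (H1 : 0 < Re (1, 0)) by (simpl; lra).
destruct (dterm_bounded a (1, 0) _ (Ha (exist _ (1, 0) H1))) as [A [HA HAk]].
(* The index [S n] stands for the integer [n + 2], and [1 / (n + 2)^2 <= 1 / (n + 1) - 1 / (n +
   2)]. *)
assert (Hdec : forall u n, Cmod (dterm a (3, u) (S n)) <= A / INR (S n) - A / INR (S (S n))).
{ intros u n.
  replace (3, u) with (((1, 0) + (2, u))%C) by (unfold Cplus; simpl; f_equal; ring).
  rewrite dterm_plus, Cmod_mult, Cmod_n_pow_opp; simpl Re.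
  replace (- (2) * lam (S n)) with (- lam (S n) + - lam (S n)) by ring.
  rewrite exp_plus, exp_Ropp, exp_lam.
  pose proof (INR_S_pos n) as Hn; rewrite (S_INR (S n)).
  apply Rle_trans with (A * (/ (INR (S n) + 1) * / (INR (S n) + 1))).
  - apply Rmult_le_compat_r; [|apply HAk].
    assert (0 < / (INR (S n) + 1)) by (apply Rinv_0_lt_compat; lra); nra.
  - replace (A / INR (S n) - A / (INR (S n) + 1))
      with (A * (/ INR (S n) * / (INR (S n) + 1))) by (field; lra).
    apply Rmult_le_compat_l; [easy|].
    apply Rmult_le_compat_r; [left; apply Rinv_0_lt_compat; lra|].
    apply Rinv_le_contravar; lra. }
assert (Hb : forall N, (j <= N)%nat -> Cmod (a (S j)) * / INR (S j) ^ 3 <= B + A / INR (S N)).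
{ intros N HjN.
  replace (/ INR (S j) ^ 3) with (Cmod (n_pow_opp (S j) (3, 0))).
  2:{ rewrite Cmod_n_pow_opp; simpl Re.
      replace (- (3) * lam j) with (- (lam j + lam j + lam j)) by ring.
      rewrite exp_Ropp, !exp_plus, exp_lam; f_equal; simpl; ring. }
  rewrite <- Cmod_mult; change (Cmod (dterm a (3, 0) j) <= B + A / INR (S N)).
  apply (trig_sum_coef_bound (dterm a (3, 0)) N); [|easy].
  intros u.
  erewrite (psum_ext _ (dterm a (3, - u))).
  2:{ intros k _; unfold dterm; rewrite !n_pow_opp_S; simpl Re; simpl Im.
      rewrite <- Ropp_0 at 1.
      rewrite !Ropp_involutive, Rmult_0_l, cis_0; ring. }
  assert (H3 : 0 < Re (3, - u)) by (simpl; lra).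
  pose proof (Ha (exist _ (3, - u) H3)) as Hs; simpl in Hs.
  pose proof (HB (exist _ (3, - u) H3)) as HBu.
  set (v := f _) in Hs, HBu.
  fold (dterm a (3, - u)) in Hs.
  assert (Ht : Cmod (v - psum (dterm a (3, - u)) N) <= A / INR (S N)).
  { apply (Cmod_limit_le _ _ _ _ N Hs); intros n Hn.
    apply telescoping_tail with (y := fun n => A / INR (S n)); [apply Hdec| |easy].
    intros m; apply Rmult_le_pos; [easy|].
    left; apply Rinv_0_lt_compat, INR_S_pos. }
  set (P := psum _ N) in Ht |- *.
  replace P with (v + - (v - P))%C by ring.
  eapply Rle_trans; [apply Cmod_triangle|]; rewrite Cmod_opp; lra. }
assert (Hp : 0 < INR (S j) ^ 3) by (apply pow_lt, INR_S_pos).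
apply Rmult_le_reg_r with (/ INR (S j) ^ 3); [now apply Rinv_0_lt_compat|].
replace (INR (S j) ^ 3 * B * / INR (S j) ^ 3) with B by (field; pose proof (INR_S_pos j); lra).
apply le_epsilon; intros e He.
destruct (INR_unbounded (A / e)) as [n Hn].
eapply Rle_trans; [apply (Hb (max j n)); lia|].
apply Rplus_le_compat_l.
apply Rmult_le_reg_r with (INR (S (max j n))); [apply INR_S_pos|].
replace (A / INR (S (max j n)) * INR (S (max j n))) with A
  by (field; pose proof (INR_S_pos (max j n)); lra).
assert (INR n <= INR (S (max j n))) by (apply le_INR; lia).
apply Rle_trans with (e * (A / e)); [right; field; lra|].
apply Rmult_le_compat_l; lra.
Qed.

(** * Growth of the tails on vertical lines *)

Lemma Rabs_sin_le (x : R) : Rabs (sin x) <= Rabs x.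
Proof.
assert (H : forall y, 0 <= y -> Rabs (sin y) <= y).
{ intros y Hy; pose proof (SIN_bound y).
  destruct (Rle_lt_dec 1 y) as [H1|H1]; [apply Rabs_le; lra|].
  destruct (Req_dec y 0) as [->|Hn]; [rewrite sin_0, Rabs_R0; lra|].
  pose proof PI2_1; rewrite Rabs_right.
  - apply Rlt_le, sin_lt_x; lra.
  - apply Rle_ge, sin_ge_0; lra. }
destruct (Rle_lt_dec 0 x) as [Hx|Hx].
- rewrite (Rabs_right x) by lra; now apply H.
- rewrite (Rabs_left x), <- Rabs_Ropp, <- sin_neg by lra; apply H; lra.
Qed.

Lemma one_minus_cos_le (x : R) : 1 - cos x <= x ^ 2 / 2.
Proof.
replace x with (2 * (x / 2)) at 1 by field; rewrite cos_2a_sin.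
pose proof (Rabs_sin_le (x / 2)) as H.
apply Rsqr_le_abs_1 in H; unfold Rsqr in H; nra.
Qed.

Lemma Cmod_cis_minus_le (x y : R) : Cmod (cis x - cis y) <= Rabs (x - y).
Proof.
rewrite <- (Rabs_right (Cmod _)) by (apply Rle_ge, Cmod_ge_0).
apply Rsqr_le_abs_0; rewrite !Rsqr_pow2, Cmod2_alt.
unfold cis; simpl Re; simpl Im.
pose proof (one_minus_cos_le (x - y)) as H; rewrite cos_minus in H.
pose proof (sin2_cos2 x) as Hx; pose proof (sin2_cos2 y) as Hy.
unfold Rsqr in Hx, Hy; nra.
Qed.

Lemma exp_lam_diff (c : R) (n : nat) : 0 <= c ->
  c * (lam (S n) - lam n) * exp (- c * lam (S n)) <=
  exp (- c * lam n) - exp (- c * lam (S n)).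
Proof.
intros Hc.
replace (- c * lam n) with (c * (lam (S n) - lam n) + - c * lam (S n)) by ring.
rewrite exp_plus.
pose proof (exp_ineq1_le (c * (lam (S n) - lam n))).
pose proof (exp_pos (- c * lam (S n))); nra.
Qed.

(** The difference splits into a change of modulus and a rotation by at most [|u|] times the
    frequency gap. [exp_lam_diff] trades that gap for the decrease of [n^(-c)] at the cost of a
    factor [1 / c], so the bound telescopes as [abel_summation] requires. *)
Lemma n_pow_opp_variation (c u : R) (n : nat) : 0 < c ->
  Cmod (n_pow_opp (S n) (c, u) - n_pow_opp (S (S n)) (c, u)) <=
  (1 + Rabs u / c) * (exp (- c * lam n) - exp (- c * lam (S n))).
Proof.
intros Hc; rewrite !n_pow_opp_S; simpl Re; simpl Im.
pose proof (exp_lam_diff c n (Rlt_le _ _ Hc)) as Hv.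
pose proof (lam_lt n (S n) (Nat.lt_succ_diag_r n)) as Hl.
assert (Hv' := exp_pos (- c * lam (S n))).
set (v := exp (- c * lam n)) in *; set (v' := exp (- c * lam (S n))) in *.
replace (v * cis (- u * lam n) - v' * cis (- u * lam (S n)))%C with
  (RtoC (v - v') * cis (- u * lam n)
   + RtoC v' * (cis (- u * lam n) - cis (- u * lam (S n))))%C
  by (rewrite RtoC_minus; ring).
eapply Rle_trans; [apply Cmod_triangle|].
rewrite !Cmod_mult, Cmod_cis, !Cmod_R.
assert (0 <= c * (lam (S n) - lam n)) by nra.
rewrite (Rabs_right v'), (Rabs_right (v - v')) by nra.
pose proof (Cmod_cis_minus_le (- u * lam n) (- u * lam (S n))) as H1.
replace (- u * lam n - - u * lam (S n)) with (u * (lam (S n) - lam n)) in H1 by ring.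
rewrite Rabs_mult, (Rabs_right (_ - _)) in H1 by lra.
assert (H2 : v' * Cmod (cis (- u * lam n) - cis (- u * lam (S n)))
          <= v' * (Rabs u * (lam (S n) - lam n))) by (apply Rmult_le_compat_l; lra).
assert (H3 : v' * (Rabs u * (lam (S n) - lam n))
  = Rabs u / c * (c * (lam (S n) - lam n) * v')) by (field; lra).
assert (H4 : Rabs u / c * (c * (lam (S n) - lam n) * v') <= Rabs u / c * (v - v')).
{ apply Rmult_le_compat_l; [|easy].
  apply Rmult_le_pos; [apply Rabs_pos|left; now apply Rinv_0_lt_compat]. }
lra.
Qed.

(** Abel summation against the bounded partial sums at the single point [sigma / 2 + i t], with
    weights [n^(-(sigma / 2 + i u))] whose variation is linear in [|u|]. The constant [A] depends on
    [f] and on the point; that suffices, because it is later overcome by the choice of [N]. *)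
Lemma dirichlet_tail_growth (a : nat -> C) (f : C0 -> C) (sigma t : R) :
  is_dirichlet_series a f -> 0 < sigma ->
  exists A, 0 <= A /\ forall u N (H : 0 < Re (sigma, t + u)),
  Cmod (f (exist _ (sigma, t + u) H) - psum (dterm a (sigma, t + u)) N) <=
  A * (1 + Rabs u) * exp (- (sigma / 2) * lam N).
Proof.
intros Ha Hs; set (c := sigma / 2); assert (Hc : 0 < c) by (unfold c; lra).
assert (H0 : 0 < Re (c, t)) by exact Hc.
destruct (is_series_C_bounded _ _ (Ha (exist _ (c, t) H0))) as [A [HA HAn]].
simpl in HAn; fold (dterm a (c, t)) in HAn.
assert (Hic : 0 < / c) by now apply Rinv_0_lt_compat.
exists (A * (1 + / c) + 2 * A); split; [nra|].
intros u N H.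
apply (Cmod_limit_le _ _ _ _ N (Ha (exist _ (sigma, t + u) H))); simpl; intros n Hn.
fold (dterm a (sigma, t + u)).
assert (E : (sigma, t + u) = Cplus (c, t) (c, u))
  by (unfold Cplus, c; simpl; f_equal; field).
rewrite E, !(psum_ext (dterm a (_ + _)) _ _ (fun k _ => dterm_plus a (c, t) (c, u) k)).
pose proof (Rabs_pos u) as Hu.
assert (Huc : 0 <= Rabs u / c) by (apply Rmult_le_pos; lra).
set (v := fun n => exp (- c * lam n)).
assert (Hab := abel_summation (dterm a (c, t)) (fun k => n_pow_opp (S k) (c, u))
  (fun n => A * (1 + Rabs u / c) * v n)).
eapply Rle_trans; [apply Hab; [|exact Hn]|].
- intros m; pose proof (n_pow_opp_variation c u m Hc) as Hm; fold (v m) (v (S m)) in Hm.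
  apply Rle_trans with (A * ((1 + Rabs u / c) * (v m - v (S m)))); [|right; ring].
  apply Rmult_le_compat; [apply Cmod_ge_0|apply Cmod_ge_0|apply HAn|exact Hm].
- rewrite !Cmod_n_pow_opp; simpl Re; fold (v n) (v N).
  assert (Hvn : 0 < v n) by apply exp_pos.
  assert (HvN : v n <= v N).
  { pose proof (lam_le N n Hn) as Hl.
    destruct (Rle_lt_or_eq_dec (- c * lam n) (- c * lam N)) as [h|h]; [nra| |].
    - left; now apply exp_increasing.
    - right; unfold v; now rewrite h. }
  pose proof (HAn n) as H1; pose proof (HAn N) as H2.
  pose proof (Cmod_ge_0 (psum (dterm a (c, t)) n)).
  assert (Cmod (psum (dterm a (c, t)) n) * v n <= A * v N) by (apply Rmult_le_compat; lra).
  assert (Cmod (psum (dterm a (c, t)) N) * v N <= A * v N) by (apply Rmult_le_compat_r; lra).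
  assert (0 <= A * (1 + Rabs u / c) * v n) by (repeat apply Rmult_le_pos; lra).
  assert (A * (1 + Rabs u / c) * v N <= A * (1 + / c) * (1 + Rabs u) * v N).
  { apply Rmult_le_compat_r; [lra|].
    rewrite Rmult_assoc; apply Rmult_le_compat_l; [easy|].
    unfold Rdiv in *; nra. }
  assert (A * v N <= A * (1 + Rabs u) * v N).
  { apply Rmult_le_compat_r; [lra|]; nra. }
  nra.
Qed.

(** * The kernel [cos^(2K)] *)

(* [beta K k] is [C(2K, K + k) / 4^K], the Fourier coefficient of index [2k] of [cos^(2K)]. *)
Fixpoint beta (K k : nat) : R :=
  match K, k with
  | O, O => 1
  | O, S _ => 0
  | S K', O => beta K' 0 / 2 + beta K' 1 / 2
  | S K', S k' => beta K' k / 2 + (beta K' k' + beta K' (S k)) / 4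
  end.

Lemma beta_ge_0 (K k : nat) : 0 <= beta K k.
Proof.
revert k; induction K as [|K IH]; intros [|k]; cbn [beta]; try lra.
- pose proof (IH O); pose proof (IH 1%nat); lra.
- pose proof (IH k); pose proof (IH (S k)); pose proof (IH (S (S k))); lra.
Qed.

Lemma beta_decr (K k : nat) : beta K (S k) <= beta K k.
Proof.
revert k; induction K as [|K IH]; intros [|k]; cbn [beta]; try lra.
- pose proof (IH O); pose proof (IH 1%nat); lra.
- pose proof (IH k); pose proof (IH (S k)); pose proof (IH (S (S k))); lra.
Qed.

Lemma beta_le_0 (K k : nat) : beta K k <= beta K 0.
Proof. induction k as [|k IH]; [lra|pose proof (beta_decr K k); lra]. Qed.

Lemma beta_out (K k : nat) : (K < k)%nat -> beta K k = 0.
Proof.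
revert k; induction K as [|K IH]; intros [|k] Hk; cbn [beta]; try lia; [easy|].
rewrite !IH by lia; lra.
Qed.

Definition cos_sum (K N : nat) (y : R) : R :=
  beta K 0 + 2 * sum_f_R0 (fun k => beta K (S k) * cos (2 * INR (S k) * y)) N.

(** With the range [N] kept fixed, multiplication by [cos y ^ 2] pushes one harmonic out of the
    range and misses the one that would come in. These two correction terms vanish by [beta_out] as
    soon as [K <= N]. *)
Lemma cos_sum_S (K N : nat) (y : R) :
  cos_sum (S K) N y = cos y ^ 2 * cos_sum K N y
    - beta K (S N) * cos (2 * INR (S (S N)) * y) / 2
    + beta K (S (S N)) * cos (2 * INR (S N) * y) / 2.
Proof.
assert (Hc : cos y ^ 2 = (1 + cos (2 * y)) / 2) by (rewrite cos_2a_cos; field).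
rewrite Hc; unfold cos_sum.
assert (Hm : forall k, cos (2 * y) * cos (2 * INR (S k) * y)
  = (cos (2 * INR (S (S k)) * y) + cos (2 * INR k * y)) / 2).
{ intros k.
  replace (2 * INR (S (S k)) * y) with (2 * INR (S k) * y + 2 * y) by (rewrite (S_INR (S k)); ring).
  replace (2 * INR k * y) with (2 * INR (S k) * y - 2 * y) by (rewrite (S_INR k); ring).
  rewrite cos_plus, cos_minus; field. }
induction N as [|N IH].
- cbn [sum_f_R0]; pose proof (Hm O) as H0.
  replace (2 * INR 0 * y) with 0 in H0 by (simpl; ring); rewrite cos_0 in H0.
  replace (2 * INR 1 * y) with (2 * y) in * by (simpl; ring).
  cbn [beta]; nra.
- rewrite !tech5; pose proof (Hm (S N)) as HN.
  replace (beta (S K) (S (S N)))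
    with (beta K (S (S N)) / 2 + (beta K (S N) + beta K (S (S (S N)))) / 4) by reflexivity.
  nra.
Qed.

Lemma cos_pow_sum (K N : nat) (y : R) : (K <= N)%nat ->
  cos y ^ (2 * K) = cos_sum K N y.
Proof.
induction K as [|K IH]; intros HK.
- unfold cos_sum; simpl beta.
  rewrite (sum_eq _ (fun _ => 0)) by (intros; ring).
  rewrite sum_cte; simpl; ring.
- rewrite cos_sum_S, <- IH, !beta_out by lia.
  replace (2 * S K)%nat with (2 * K + 2)%nat by lia; rewrite pow_add; field.
Qed.

(** The primitive of [cos y ^ (2 * K)] vanishing at 0. Written as a sine polynomial, it gives the
    kernel masses by evaluation and the Fourier coefficients of the cutoff by inspection. *)
Definition cos_prim (K : nat) (y : R) : R :=
  beta K 0 * y + sum_f_R0 (fun k => beta K (S k) * (sin (2 * INR (S k) * y) / INR (S k))) K.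

Lemma is_derive_cos_prim (K : nat) (y : R) :
  is_derive (cos_prim K) y (cos y ^ (2 * K)).
Proof.
rewrite (cos_pow_sum K K y (le_n _)); unfold cos_prim, cos_sum.
apply (@is_derive_plus R_AbsRing R_NormedModule (fun y => beta K 0 * y)).
- evar_last; [apply is_derive_scal, is_derive_id|unfold one; simpl; ring].
- generalize K at 2 4; intros N.
  assert (H : forall k, is_derive (fun y => beta K (S k) * (sin (2 * INR (S k) * y) / INR (S k))) y
    (2 * (beta K (S k) * cos (2 * INR (S k) * y)))).
  { intros k; pose proof (INR_S_pos k) as Hk; revert Hk; generalize (INR (S k)); intros n Hn.
    auto_derive; [easy|field; lra]. }
  induction N as [|N IH]; [apply H|].
  rewrite tech5, Rmult_plus_distr_l; simpl.
  now apply (@is_derive_plus R_AbsRing R_NormedModule).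
Qed.

Lemma cos_prim_0 (K : nat) : cos_prim K 0 = 0.
Proof.
unfold cos_prim; rewrite (sum_eq _ (fun _ => 0)); [rewrite sum_cte; ring|].
intros k _; rewrite !Rmult_0_r, sin_0; field; pose proof (INR_S_pos k); lra.
Qed.

Lemma cos_prim_opp (K : nat) (y : R) : cos_prim K (- y) = - cos_prim K y.
Proof.
unfold cos_prim.
rewrite (sum_eq _ (fun k => beta K (S k) * (sin (2 * INR (S k) * y) / INR (S k)) * -1)).
- rewrite <- scal_sum; ring.
- intros k _; replace (2 * INR (S k) * - y) with (- (2 * INR (S k) * y)) by ring.
  rewrite sin_neg; unfold Rdiv; ring.
Qed.

Lemma sin_INR_PI (n : nat) : sin (INR n * PI) = 0.
Proof.
induction n as [|n IH]; [simpl; rewrite Rmult_0_l; apply sin_0|].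
rewrite S_INR, Rmult_plus_distr_r, Rmult_1_l, neg_sin, IH; ring.
Qed.

Lemma cos_prim_PI2 (K : nat) : cos_prim K (PI / 2) = beta K 0 * (PI / 2).
Proof.
unfold cos_prim; rewrite (sum_eq _ (fun _ => 0)); [rewrite sum_cte; ring|].
intros k _; replace (2 * INR (S k) * (PI / 2)) with (INR (S k) * PI) by field.
rewrite sin_INR_PI; field; pose proof (INR_S_pos k); lra.
Qed.

Lemma derive_nonneg_le (f df : R -> R) (a b : R) : a <= b ->
  (forall x, is_derive f x (df x)) -> (forall x, a <= x <= b -> 0 <= df x) -> f a <= f b.
Proof.
intros Hab Hf Hpos.
destruct (MVT_gen f a b df) as [c [Hc E]].
- intros x _; apply Hf.
- intros x _; apply continuity_pt_filterlim, (@ex_derive_continuous R_AbsRing R_NormedModule).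
  now exists (df x).
- rewrite Rmin_left, Rmax_right in Hc by easy; specialize (Hpos c Hc); nra.
Qed.

Lemma cos_prim_le (K : nat) (x y : R) : x <= y -> cos_prim K x <= cos_prim K y.
Proof.
intros H; apply (derive_nonneg_le _ _ _ _ H (is_derive_cos_prim K)).
intros z _; rewrite pow_mult; apply pow_le, pow2_ge_0.
Qed.

Lemma bernoulli (x : R) (n : nat) : 0 <= x <= 1 -> 1 - INR n * x <= (1 - x) ^ n.
Proof.
intros Hx; induction n as [|n IH]; [simpl; lra|].
rewrite S_INR; simpl; pose proof (pos_INR n); nra.
Qed.

(** [beta K 0] is the mean of [cos^(2K)], of order [1 / sqrt K]; taking [K] a square spares the
    root. The mass of the kernel on [[0, PI / 2]] is at least its mass on [[0, 1 / (2r)]], where the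
    kernel is at least [3 / 4]. *)
Lemma beta_0_lower (r : nat) : (1 <= r)%nat ->
  / beta (r * r) 0 <= 4 * PI * INR r / 3 /\ 0 < beta (r * r) 0.
Proof.
intros Hr; set (K := (r * r)%nat).
assert (Hr1 : 1 <= INR r) by (apply (le_INR 1); easy).
assert (HPI := PI2_1).
assert (Hi : 0 < / INR r <= 1).
{ split; [apply Rinv_0_lt_compat; lra|].
  rewrite <- Rinv_1; apply Rinv_le_contravar; lra. }
assert (H : 3 / 4 * (/ INR r / 2) <= cos_prim K (/ INR r / 2)).
{ assert (H0 : cos_prim K 0 - 3 / 4 * 0 <= cos_prim K (/ INR r / 2) - 3 / 4 * (/ INR r / 2)).
  { apply (derive_nonneg_le (fun y => cos_prim K y - 3 / 4 * y) (fun y => cos y ^ (2 * K) - 3 / 4)).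
    - lra.
    - intros x; apply (@is_derive_minus R_AbsRing R_NormedModule); [apply is_derive_cos_prim|].
      evar_last; [apply is_derive_scal, is_derive_id|unfold one; simpl; ring].
    - intros y Hy; rewrite pow_mult.
      (* Then Bernoulli gives [cos y ^ (2 * K) >= (1 - y^2)^K >= 1 - K y^2], and [K y^2 <= 1 / 4] on
         this interval. *)
      assert (Hc : 1 - y ^ 2 <= cos y ^ 2).
      { pose proof (Rabs_sin_le y) as Hs; apply Rsqr_le_abs_1 in Hs.
        pose proof (sin2_cos2 y) as Hsc; unfold Rsqr in *; nra. }
      assert (Hy2 : 0 <= y ^ 2 <= 1 / 4 * (/ INR r * / INR r)) by nra.
      assert (Hy1 : y ^ 2 <= 1) by nra.
      pose proof (pow_incr (1 - y ^ 2) (cos y ^ 2) K ltac:(lra)) as Hc'.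
      pose proof (bernoulli (y ^ 2) K (conj (proj1 Hy2) Hy1)) as HB.
      assert (HK : INR K * y ^ 2 <= 1 / 4).
      { unfold K; rewrite mult_INR.
        apply Rle_trans with (INR r * INR r * (1 / 4 * (/ INR r * / INR r))).
        - apply Rmult_le_compat_l; nra.
        - right; field; lra. }
      lra. }
  rewrite cos_prim_0 in H0; lra. }
assert (H1 : cos_prim K (/ INR r / 2) <= cos_prim K (PI / 2)) by (apply cos_prim_le; lra).
rewrite cos_prim_PI2 in H1.
assert (Hb : 3 / (4 * PI) * / INR r <= beta K 0).
{ apply Rmult_le_reg_r with (PI / 2); [lra|].
  replace (3 / (4 * PI) * / INR r * (PI / 2)) with (3 / 4 * (/ INR r / 2)) by (field; lra).
  lra. }
assert (Hp : 0 < 3 / (4 * PI) * / INR r).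
{ apply Rmult_lt_0_compat; [apply Rdiv_lt_0_compat|]; lra. }
split; [|lra].
replace (4 * PI * INR r / 3) with (/ (3 / (4 * PI) * / INR r)) by (field; lra).
now apply Rinv_le_contravar.
Qed.

Lemma sin_ge_half (y : R) : 0 <= y <= 1 -> y / 2 <= sin y.
Proof.
intros Hy.
assert (H : sin 0 - 0 / 2 <= sin y - y / 2).
{ apply (derive_nonneg_le (fun y => sin y - y / 2) (fun y => cos y - / 2)); [lra| |].
  - intros x; auto_derive; [easy|field].
  - intros x Hx; pose proof (one_minus_cos_le x); nra. }
rewrite sin_0 in H; lra.
Qed.

(* On [y0, PI/2] the weight [cos^(2K)] is at most [sin y / sin y0] times itself, and
   [cos^(2K-1) * sin] has the primitive [- cos^(2K) / (2K)]. *)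
Lemma cos_prim_tail (r : nat) (y0 : R) : (1 <= r)%nat -> 0 < y0 <= 1 ->
  (beta (r * r) 0 * (PI / 2) - cos_prim (r * r) y0) / beta (r * r) 0 <=
  4 * PI / 3 * exp (- (INR r * y0) ^ 2 / 4) / (INR r * y0).
Proof.
intros Hr Hy.
destruct (beta_0_lower r Hr) as [Hb Hb0].
assert (Hr1 : 1 <= INR r) by (apply (le_INR 1); easy).
set (K := (r * r)%nat) in *.
assert (HK : exists K', (2 * K = S K')%nat /\ 2 * INR K = INR (S K')).
{ exists (2 * K - 1)%nat; assert (1 <= K)%nat by (unfold K; nia).
  replace (S (2 * K - 1)) with (2 * K)%nat by lia; split; [lia|rewrite mult_INR; simpl; ring]. }
destruct HK as [K' [EK EK']].
assert (HKr : INR K = INR r * INR r) by apply mult_INR.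
assert (HPI := PI2_1).
assert (Hs := sin_ge_half y0 (conj (Rlt_le _ _ (proj1 Hy)) (proj2 Hy))).
set (M := / (2 * INR K * sin y0)).
assert (HM : 0 < M) by (apply Rinv_0_lt_compat; repeat apply Rmult_lt_0_compat; nra).
assert (H : - cos_prim K y0 - M * cos y0 ^ (2 * K)
   <= - cos_prim K (PI / 2) - M * cos (PI / 2) ^ (2 * K)).
{ apply (derive_nonneg_le (fun y => - cos_prim K y - M * cos y ^ (2 * K))
    (fun y => - cos y ^ (2 * K) + M * (2 * INR K * cos y ^ K' * sin y))); [lra| |].
  - intros y.
    apply (@is_derive_plus R_AbsRing R_NormedModule (fun y => - cos_prim K y) (fun y => - (M * cos y ^ (2 * K))));
      [apply (@is_derive_opp R_AbsRing R_NormedModule), is_derive_cos_prim|].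
    rewrite EK, EK'; auto_derive; [easy|]; simpl pred; change (match K' with O => 1 | S _ => INR K' + 1 end) with (INR (S K')); ring.
  - intros y Hyy.
    assert (Hc : 0 <= cos y) by (apply cos_ge_0; lra).
    assert (Hc1 := COS_bound y).
    assert (Hsy : sin y0 <= sin y) by (apply sin_incr_1; lra).
    rewrite EK; simpl pow.
    replace (M * (2 * INR K * cos y ^ K' * sin y)) with (cos y ^ K' * (sin y / sin y0))
      by (unfold M; field; nra).
    assert (1 <= sin y / sin y0).
    { apply Rmult_le_reg_r with (sin y0); [lra|]; unfold Rdiv.
      rewrite Rmult_assoc, Rinv_l by lra; lra. }
    assert (0 <= cos y ^ K') by now apply pow_le.
    nra. }
rewrite cos_PI2, pow_i, cos_prim_PI2 in H by lia.
assert (Hexp : cos y0 ^ (2 * K) <= exp (- (INR r * y0) ^ 2 / 4)).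
{ rewrite pow_mult.
  apply Rle_trans with (exp (- (y0 ^ 2 / 4)) ^ K).
  - apply pow_incr; split; [apply pow2_ge_0|].
    apply Rle_trans with (1 + - (y0 ^ 2 / 4)); [|apply exp_ineq1_le].
    pose proof (sin2_cos2 y0) as Hsc; unfold Rsqr in Hsc; nra.
  - right; rewrite <- Rpower_pow by apply exp_pos; unfold Rpower; rewrite ln_exp.
    f_equal; rewrite HKr; field. }
assert (HM1 : M <= / (INR r * INR r * y0)).
{ apply Rinv_le_contravar; [repeat apply Rmult_lt_0_compat; lra|].
  rewrite HKr.
  replace (INR r * INR r * y0) with (2 * (INR r * INR r) * (y0 / 2)) by field.
  apply Rmult_le_compat_l; nra. }
assert (He := exp_pos (- (INR r * y0) ^ 2 / 4)); set (E := exp _) in *.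
assert (Hnum : beta K 0 * (PI / 2) - cos_prim K y0 <= / (INR r * INR r * y0) * E).
{ apply Rle_trans with (M * cos y0 ^ (2 * K)); [lra|].
  apply Rmult_le_compat; [lra| |easy|easy].
  rewrite pow_mult; apply pow_le, pow2_ge_0. }
replace (4 * PI / 3 * E / (INR r * y0)) with
  (/ (INR r * INR r * y0) * E * (4 * PI * INR r / 3)) by (field; lra).
unfold Rdiv at 1; apply Rmult_le_compat; [|left; now apply Rinv_0_lt_compat|easy|easy].
pose proof (cos_prim_le K y0 (PI / 2) ltac:(lra)) as Hle; rewrite cos_prim_PI2 in Hle; lra.
Qed.

(** * The smooth cutoff *)

Lemma trig_sum_cos_mult (b : nat -> C) (N : nat) (B U v : R) :
  (forall u, Rabs u <= U -> Cmod (psum (fun k => b k * cis (u * lam k))%C N) <= B) ->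
  Rabs v <= U -> Cmod (psum (fun k => RtoC (cos (v * lam k)) * b k)%C N) <= B.
Proof.
intros HB Hv.
pose proof (HB v Hv) as H1.
assert (H2 := HB (- v)); rewrite Rabs_Ropp in H2; specialize (H2 Hv).
replace (psum _ N) with (RtoC (/ 2) *
  (psum (fun k => b k * cis (v * lam k)) N + psum (fun k => b k * cis (- v * lam k)) N))%C.
- rewrite Cmod_mult, Cmod_R, Rabs_right by lra.
  pose proof (Cmod_triangle (psum (fun k => b k * cis (v * lam k))%C N)
    (psum (fun k => b k * cis (- v * lam k))%C N)); lra.
- rewrite <- psum_plus, <- psum_scal; apply psum_ext; intros k _.
  replace (cos (v * lam k)) with (/ 2 * (2 * cos (v * lam k))) by field.
  rewrite RtoC_mult, cis_cos; replace (- v * lam k) with (- (v * lam k)) by ring; ring.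
Qed.

(** The bound is requested only for heights up to [U]: for a partial sum of [f] it will come from
    [|f| <= B] plus a tail that grows with the height, hence on a bounded range only. *)
Lemma trig_sum_multiplier (b : nat -> C) (N : nat) (B U A : R) (c v : nat -> R) (n : nat) :
  (forall u, Rabs u <= U -> Cmod (psum (fun k => b k * cis (u * lam k))%C N) <= B) ->
  0 <= U -> (forall i, (i <= n)%nat -> Rabs (v i) <= U) ->
  Cmod (psum (fun k =>
    RtoC (A + sum_f_R0 (fun i => c i * cos (v i * lam k)) n)%R * b k)%C N) <=
  (Rabs A + sum_f_R0 (fun i => Rabs (c i)) n) * B.
Proof.
intros HB HU Hv.
assert (Hstep : forall (g : nat -> R) (G d w : R),
  Cmod (psum (fun k => RtoC (g k) * b k)%C N) <= G * B -> Rabs w <= U ->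
  Cmod (psum (fun k => RtoC (g k + d * cos (w * lam k))%R * b k)%C N) <= (G + Rabs d) * B).
{ intros g G d w HG Hw.
  replace (psum _ N) with (psum (fun k => RtoC (g k) * b k) N
    + RtoC d * psum (fun k => RtoC (cos (w * lam k)) * b k) N)%C.
  - eapply Rle_trans; [apply Cmod_triangle|]; rewrite Cmod_mult, Cmod_R.
    pose proof (trig_sum_cos_mult b N B U w HB Hw); pose proof (Rabs_pos d).
    rewrite Rmult_plus_distr_r; apply Rplus_le_compat; [easy|].
    now apply Rmult_le_compat_l.
  - rewrite <- psum_scal, <- psum_plus; apply psum_ext; intros k _.
    rewrite RtoC_plus, RtoC_mult; ring. }
assert (H0 : Cmod (psum (fun k => RtoC A * b k)%C N) <= Rabs A * B).
{ rewrite psum_scal, Cmod_mult, Cmod_R; apply Rmult_le_compat_l; [apply Rabs_pos|].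
  specialize (HB 0); rewrite Rabs_R0 in HB; specialize (HB HU).
  erewrite psum_ext; [exact HB|].
  intros k _; simpl; rewrite Rmult_0_l, cis_0; ring. }
induction n as [|n IH]; simpl.
- apply (Hstep (fun _ => A)); [easy|apply Hv; lia].
- rewrite <- Rplus_assoc.
  erewrite psum_ext; [apply (Hstep (fun k => A + sum_f_R0 (fun i => c i * cos (v i * lam k)) n)
    (Rabs A + sum_f_R0 (fun i => Rabs (c i)) n) (c (S n)) (v (S n)))|].
  + apply IH; intros i Hi; apply Hv; lia.
  + apply Hv; lia.
  + intros k _; simpl; now rewrite Rplus_assoc.
Qed.

Lemma ln_incr_lower (x y : R) : 0 < x -> 0 < y -> (y - x) / y <= ln y - ln x.
Proof.
intros Hx Hy.
assert (H := exp_ineq1_le (ln x - ln y)).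
unfold Rminus at 2 in H; rewrite exp_plus, exp_Ropp, !exp_ln in H by easy.
replace ((y - x) / y) with (1 - x * / y) by (field; lra); lra.
Qed.

(* [|sin (k phi)| / k] is at most [min (phi, 1 / k)], which is at most
   [2 phi / (1 + k phi)]; this bound telescopes against a logarithm. *)
Lemma sin_div_le (k : nat) (phi : R) : 0 <= phi ->
  Rabs (sin (INR (S k) * phi)) / INR (S k) <=
  2 * (ln (1 + INR (S k) * phi) - ln (1 + INR k * phi)).
Proof.
intros Hphi; pose proof (INR_S_pos k) as Hk; pose proof (pos_INR k) as Hk0.
set (n := INR (S k)) in *.
assert (Hn : 0 <= n * phi) by nra.
assert (H0 : 0 <= INR k * phi) by nra.
pose proof (ln_incr_lower (1 + INR k * phi) (1 + n * phi) ltac:(lra) ltac:(lra)) as Hl.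
replace (1 + n * phi - (1 + INR k * phi)) with phi in Hl by (unfold n; rewrite S_INR; ring).
pose proof (Rabs_sin_le (n * phi)) as Hs; rewrite (Rabs_right (n * phi)) in Hs by lra.
pose proof (SIN_bound (n * phi)) as Hb; assert (Hs1 : Rabs (sin (n * phi)) <= 1) by (apply Rabs_le; lra).
pose proof (Rabs_pos (sin (n * phi))) as Hs0.
apply Rle_trans with (2 * (phi / (1 + n * phi))); [|lra].
apply Rmult_le_reg_r with (n * (1 + n * phi)); [nra|].
replace (Rabs (sin (n * phi)) / n * (n * (1 + n * phi)))
  with (Rabs (sin (n * phi)) * (1 + n * phi)) by (field; lra).
replace (2 * (phi / (1 + n * phi)) * (n * (1 + n * phi))) with (2 * (n * phi)) by (field; lra).
nra.
Qed.

Lemma sum_beta_le (K : nat) : sum_f_R0 (fun k => beta K (S k)) K <= 1 / 2.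
Proof.
pose proof (cos_pow_sum K K 0 (le_n _)) as H; rewrite cos_0, pow1 in H.
unfold cos_sum in H.
rewrite (sum_eq _ (fun k => beta K (S k))) in H.
- pose proof (beta_ge_0 K 0); lra.
- intros k _; rewrite Rmult_0_r, cos_0; ring.
Qed.

(** About [r], the square root of [K], harmonics matter. Up to [r] the ratio of the [beta] is at
    most 1 and [sin_div_le] telescopes to the logarithm. Beyond [r] the sine quotient is at most
    [1 / r], while the [beta (S k)] sum to at most [1 / 2] and [1 / beta (r * r) 0] is at most
    [4 PI r / 3]; this part contributes [2 PI / 3]. *)
Lemma kernel_weight_sum (r : nat) (phi : R) : (1 <= r)%nat -> 0 <= phi ->
  sum_f_R0 (fun k => beta (r * r) (S k) / beta (r * r) 0 *
    (Rabs (sin (INR (S k) * phi)) / INR (S k))) (r * r) <=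
  2 * ln (1 + INR r * phi) + 2 * PI / 3.
Proof.
intros Hr Hphi; destruct (beta_0_lower r Hr) as [Hb Hb0].
set (K := (r * r)%nat) in *.
assert (Hr1 : 1 <= INR r) by (apply (le_INR 1); easy).
assert (Hi0 : 0 < / beta K 0) by now apply Rinv_0_lt_compat.
(* Freezing the logarithm beyond [r] lets both ranges share one termwise bound. *)
set (l := fun k => ln (1 + INR (Nat.min k r) * phi)).
assert (Hl : forall k, ln (1 + INR k * phi) <= ln (1 + INR (S k) * phi)).
{ intros k; pose proof (sin_div_le k phi Hphi).
  pose proof (Rabs_pos (sin (INR (S k) * phi))).
  assert (0 <= Rabs (sin (INR (S k) * phi)) / INR (S k)).
  { apply Rmult_le_pos; [easy|left; apply Rinv_0_lt_compat, INR_S_pos]. }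
  lra. }
assert (Hterm : forall k, beta K (S k) / beta K 0 * (Rabs (sin (INR (S k) * phi)) / INR (S k))
  <= 2 * (l (S k) - l k) + beta K (S k) * (/ beta K 0 * / INR r)).
{ intros k; pose proof (beta_ge_0 K (S k)) as Hb1.
  pose proof (INR_S_pos k) as Hk.
  assert (Hs0 : 0 <= Rabs (sin (INR (S k) * phi)) / INR (S k)).
  { apply Rmult_le_pos; [apply Rabs_pos|left; now apply Rinv_0_lt_compat]. }
  assert (Hir : 0 < / INR r) by (apply Rinv_0_lt_compat; lra).
  destruct (Nat.le_gt_cases (S k) r) as [h|h].
  - unfold l; rewrite !Nat.min_l by lia.
    pose proof (sin_div_le k phi Hphi).
    assert (beta K (S k) / beta K 0 <= 1).
    { pose proof (beta_le_0 K (S k)); apply Rmult_le_reg_r with (beta K 0); [easy|].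
      unfold Rdiv; rewrite Rmult_assoc, Rinv_l by lra; lra. }
    assert (0 <= beta K (S k) * (/ beta K 0 * / INR r)).
    { repeat apply Rmult_le_pos; lra. }
    nra.
  - unfold l; rewrite !Nat.min_r by lia.
    rewrite Rminus_diag, Rmult_0_r, Rplus_0_l; unfold Rdiv at 1.
    rewrite Rmult_assoc; apply Rmult_le_compat_l; [easy|].
    apply Rmult_le_compat_l; [lra|].
    assert (Hle : / INR (S k) <= / INR r) by (apply Rinv_le_contravar; [lra|apply le_INR; lia]).
    assert (0 < / INR (S k)) by now apply Rinv_0_lt_compat.
    pose proof (SIN_bound (INR (S k) * phi)) as Hsb.
    assert (Rabs (sin (INR (S k) * phi)) <= 1) by (apply Rabs_le; lra).
    pose proof (Rabs_pos (sin (INR (S k) * phi))); unfold Rdiv; nra. }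
assert (Htel : forall n, sum_f_R0 (fun k => 2 * (l (S k) - l k)) n = 2 * l (S n)).
{ induction n as [|n IH]; simpl sum_f_R0; [|rewrite IH; ring].
  unfold l at 2; simpl; rewrite Rmult_0_l, Rplus_0_r, ln_1; ring. }
eapply Rle_trans; [apply sum_Rle; intros k _; apply Hterm|].
rewrite plus_sum, Htel, <- scal_sum.
assert (Hmax : l (S K) = ln (1 + INR r * phi)).
{ unfold l; rewrite Nat.min_r; [easy|unfold K; nia]. }
rewrite Hmax; apply Rplus_le_compat_l.
pose proof (sum_beta_le K) as HS.
assert (H1 : / beta K 0 * / INR r <= 4 * PI / 3).
{ apply Rmult_le_reg_r with (INR r); [lra|].
  rewrite Rmult_assoc, Rinv_l by lra; lra. }
assert (0 < / INR r) by (apply Rinv_0_lt_compat; lra).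
assert (0 <= / beta K 0 * / INR r) by (apply Rmult_le_pos; lra).
assert (0 <= sum_f_R0 (fun k => beta K (S k)) K).
{ apply cond_pos_sum; intros; apply beta_ge_0. }
pose proof PI2_1; nra.
Qed.

(* A smooth cutoff of [lam <= L]: the convolution of the indicator of [-L, L] with the
   normalised weight [cos^(2K)] at scale [d], where [K = r * r]. *)
Definition cutoff (r : nat) (d L x : R) : R :=
  (cos_prim (r * r) (d * (x + L)) - cos_prim (r * r) (d * (x - L)))
  / (PI * beta (r * r) 0).

(** The Fourier coefficients of the convolution are those of the kernel times those of the interval,
    namely [sin (n phi) / n] with [phi = 2 d L]. The frequencies are [2 n d] with
    [n <= K + 1 <= 2 K], whence the range of heights. The constant 3 covers the mean value, at most
    1, and the [4 / 3] left by [kernel_weight_sum] after multiplication by [2 / PI]. *)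
Lemma trig_sum_cutoff (b : nat -> C) (N r : nat) (B d L : R) :
  (1 <= r)%nat -> 0 < d -> 0 <= L -> d * L <= 1 -> 0 <= B ->
  (forall u, Rabs u <= 4 * INR (r * r) * d ->
     Cmod (psum (fun k => b k * cis (u * lam k))%C N) <= B) ->
  Cmod (psum (fun k => RtoC (cutoff r d L (lam k)) * b k)%C N) <=
  (3 + 2 * ln (1 + 2 * INR r * d * L)) * B.
Proof.
intros Hr Hd HL HdL HB0 HB; destruct (beta_0_lower r Hr) as [Hb Hb0].
assert (HK1 : 1 <= INR (r * r)) by (apply (le_INR 1); nia).
assert (HPI := PI2_1).
set (phi := 2 * d * L); assert (Hphi : 0 <= phi) by (unfold phi; nra).
pose proof (kernel_weight_sum r phi Hr Hphi) as HW.
set (K := (r * r)%nat) in *.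
set (c := fun i => 2 / PI * (beta K (S i) / beta K 0 * (sin (INR (S i) * phi) / INR (S i)))).
set (v := fun i => 2 * INR (S i) * d).
(* By [sin (p + q) - sin (p - q) = 2 cos p sin q], applied harmonic by harmonic. *)
assert (Hp : forall x, cutoff r d L x
  = 2 * d * L / PI + sum_f_R0 (fun i => c i * cos (v i * x)) K).
{ intros x; unfold cutoff, cos_prim; fold K.
  replace (sum_f_R0 (fun i => c i * cos (v i * x)) K) with
    ((sum_f_R0 (fun k => beta K (S k) * (sin (2 * INR (S k) * (d * (x + L))) / INR (S k))) K
     - sum_f_R0 (fun k => beta K (S k) * (sin (2 * INR (S k) * (d * (x - L))) / INR (S k))) K)
     * / (PI * beta K 0)).
  - field; lra.
  - rewrite <- minus_sum, Rmult_comm, scal_sum; apply sum_eq; intros i _.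
    pose proof (INR_S_pos i); unfold c, v, phi.
    replace (2 * INR (S i) * (d * (x + L)))
      with (2 * INR (S i) * d * x + INR (S i) * (2 * d * L)) by ring.
    replace (2 * INR (S i) * (d * (x - L)))
      with (2 * INR (S i) * d * x - INR (S i) * (2 * d * L)) by ring.
    rewrite sin_plus, sin_minus; field; lra. }
rewrite (psum_ext _ (fun k => RtoC (2 * d * L / PI
  + sum_f_R0 (fun i => c i * cos (v i * lam k)) K)%R * b k)%C)
  by (intros k _; now rewrite Hp).
eapply Rle_trans; [apply (trig_sum_multiplier b N B _ _ c v K HB)|].
- repeat apply Rmult_le_pos; lra.
- intros i Hi; unfold v; pose proof (INR_S_pos i).
  rewrite Rabs_right by (apply Rle_ge; repeat apply Rmult_le_pos; lra).
  assert (INR (S i) <= 2 * INR K).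
  { rewrite S_INR; apply le_INR in Hi; lra. }
  nra.
- apply Rmult_le_compat_r; [easy|].
  assert (HA : Rabs (2 * d * L / PI) <= 1).
  { assert (0 < / PI < / 2 \/ 0 < / PI <= / 2) as HiP.
    { right; split; [apply Rinv_0_lt_compat; lra|apply Rinv_le_contravar; lra]. }
    rewrite Rabs_right; unfold Rdiv; [nra|].
    apply Rle_ge; repeat apply Rmult_le_pos; lra. }
  assert (Hc : sum_f_R0 (fun i => Rabs (c i)) K
    <= 2 / PI * (2 * ln (1 + INR r * phi) + 2 * PI / 3)).
  { rewrite (sum_eq _ (fun i => (beta K (S i) / beta K 0
      * (Rabs (sin (INR (S i) * phi)) / INR (S i))) * (2 / PI))).
    - rewrite <- scal_sum; apply Rmult_le_compat_l; [|exact HW].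
      left; apply Rdiv_lt_0_compat; lra.
    - intros i _; pose proof (INR_S_pos i); unfold c.
      pose proof (beta_ge_0 K (S i)).
      rewrite Rabs_mult, (Rabs_right (2 / PI)) by (apply Rle_ge; left; apply Rdiv_lt_0_compat; lra).
      rewrite Rabs_mult, (Rabs_right (_ / beta K 0)).
      + unfold Rdiv at 3; rewrite Rabs_mult, (Rabs_right (/ INR (S i))).
        * unfold Rdiv; ring.
        * apply Rle_ge; left; now apply Rinv_0_lt_compat.
      + apply Rle_ge, Rmult_le_pos; [easy|left; now apply Rinv_0_lt_compat]. }
  assert (Hln : 0 <= ln (1 + INR r * phi)).
  { rewrite <- ln_1; assert (0 <= INR r * phi) by (apply Rmult_le_pos; [apply pos_INR|easy]).
    destruct (Req_dec (INR r * phi) 0) as [->|Hn]; [rewrite Rplus_0_r; lra|].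
    left; apply ln_increasing; lra. }
  replace (2 * INR r * d * L) with (INR r * phi) by (unfold phi; ring).
  replace (2 / PI * (2 * ln (1 + INR r * phi) + 2 * PI / 3))
    with (2 / PI * (2 * ln (1 + INR r * phi)) + 4 / 3) in Hc by (field; lra).
  assert (2 / PI <= 1).
  { apply Rmult_le_reg_r with PI; [lra|]; unfold Rdiv; rewrite Rmult_assoc, Rinv_l; lra. }
  nra.
Qed.

(** A Gaussian tail: [cos y ^ (2 * (r * r))] behaves like a Gaussian of width [1 / r], and [x] is
    the distance to the edge of the cutoff in units of the kernel width. *)
Definition cutoff_error (x : R) : R := 4 * PI / 3 * exp (- x ^ 2 / 4) / x.

(** The defect from 1 is the kernel mass beyond [d * (x + L)] and beyond [d * (L - x)], both at
    least [d * g]. The hypothesis [d * (x + L) <= 1] keeps these points below [PI / 2], before the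
    next bump of the periodic kernel. *)
Lemma cutoff_inside (r : nat) (d L x g : R) :
  (1 <= r)%nat -> 0 < d -> 0 <= x -> 0 < g -> x + g <= L -> d * (x + L) <= 1 ->
  Rabs (cutoff r d L x - 1) <= cutoff_error (INR r * (d * g)).
Proof.
intros Hr Hd Hx Hg HgL Hd1.
destruct (beta_0_lower r Hr) as [_ Hb0].
assert (Hdg : 0 < d * g <= 1) by (split; nra).
pose proof (cos_prim_tail r (d * g) Hr Hdg) as HE; unfold cutoff_error, cutoff.
set (E := 4 * PI / 3 * _ / _) in *; set (K := (r * r)%nat) in *.
pose proof PI2_1 as HPI.
replace (d * (x - L)) with (- (d * (L - x))) by ring; rewrite cos_prim_opp.
assert (H1 : cos_prim K (d * g) <= cos_prim K (d * (x + L))) by (apply cos_prim_le; nra).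
assert (H2 : cos_prim K (d * g) <= cos_prim K (d * (L - x))) by (apply cos_prim_le; nra).
assert (H3 : cos_prim K (d * (x + L)) <= beta K 0 * (PI / 2))
  by (rewrite <- cos_prim_PI2; apply cos_prim_le; nra).
assert (H4 : cos_prim K (d * (L - x)) <= beta K 0 * (PI / 2))
  by (rewrite <- cos_prim_PI2; apply cos_prim_le; nra).
assert (HE' : beta K 0 * (PI / 2) - cos_prim K (d * g) <= E * beta K 0).
{ apply Rmult_le_reg_r with (/ beta K 0); [now apply Rinv_0_lt_compat|].
  rewrite (Rmult_assoc E), Rinv_r by lra; lra. }
assert (HPb : 0 < PI * beta K 0) by (apply Rmult_lt_0_compat; lra).
assert (HiPb : 0 < / (PI * beta K 0)) by now apply Rinv_0_lt_compat.
set (s1 := cos_prim K (d * (x + L))) in *; set (s2 := cos_prim K (d * (L - x))) in *.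
replace ((s1 - - s2) / (PI * beta K 0) - 1) with
  (- ((beta K 0 * (PI / 2) - s1 + (beta K 0 * (PI / 2) - s2)) / (PI * beta K 0)))
  by (field; lra).
rewrite Rabs_Ropp, Rabs_right by (apply Rle_ge, Rmult_le_pos; lra).
apply Rmult_le_reg_r with (PI * beta K 0); [easy|].
unfold Rdiv; rewrite Rmult_assoc, Rinv_l by lra; nra.
Qed.

(** Here the cutoff is the kernel mass between [d * (x - L)] and [d * (x + L)], which lies inside a
    single tail. *)
Lemma cutoff_outside (r : nat) (d L x g : R) :
  (1 <= r)%nat -> 0 < d -> 0 <= L -> 0 < g -> L + g <= x -> d * (x + L) <= 1 ->
  Rabs (cutoff r d L x) <= cutoff_error (INR r * (d * g)).
Proof.
intros Hr Hd HL Hg HgL Hd1.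
destruct (beta_0_lower r Hr) as [_ Hb0].
assert (Hdg : 0 < d * g <= 1) by (split; nra).
pose proof (cos_prim_tail r (d * g) Hr Hdg) as HE; unfold cutoff_error, cutoff.
set (E := 4 * PI / 3 * _ / _) in *; set (K := (r * r)%nat) in *.
pose proof PI2_1 as HPI.
assert (H1 : cos_prim K (d * g) <= cos_prim K (d * (x - L))) by (apply cos_prim_le; nra).
assert (H2 : cos_prim K (d * (x - L)) <= cos_prim K (d * (x + L))) by (apply cos_prim_le; nra).
assert (H3 : cos_prim K (d * (x + L)) <= beta K 0 * (PI / 2))
  by (rewrite <- cos_prim_PI2; apply cos_prim_le; nra).
assert (HE' : beta K 0 * (PI / 2) - cos_prim K (d * g) <= E * beta K 0).
{ apply Rmult_le_reg_r with (/ beta K 0); [now apply Rinv_0_lt_compat|].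
  rewrite (Rmult_assoc E), Rinv_r by lra; lra. }
assert (HPb : 0 < PI * beta K 0) by (apply Rmult_lt_0_compat; lra).
rewrite Rabs_right by (apply Rle_ge, Rmult_le_pos; [lra|left; now apply Rinv_0_lt_compat]).
apply Rmult_le_reg_r with (PI * beta K 0); [easy|].
unfold Rdiv; rewrite Rmult_assoc, Rinv_l by lra; nra.
Qed.

(** * Partial sums of bounded Dirichlet series *)

(** At distance at least [1 / (2m)] one has [Y^2 g >= 20], so the Gaussian exponent exceeds [5 g].
    The linear rate 5 is what becomes a fifth power of the index when [g] is a difference of
    logarithms. *)
Lemma cutoff_error_bound (m Y g0 g : R) :
  2 <= m -> Y = m ^ 6 -> / (2 * m) <= g0 -> g0 <= g ->
  cutoff_error (Y * g) <= 11 * m / Y * exp (- (5 * g)).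
Proof.
intros Hm HY Hg0 Hg; unfold cutoff_error.
assert (Him : 0 < / (2 * m)) by (apply Rinv_0_lt_compat; lra).
assert (HY0 : 0 < Y) by (rewrite HY; apply pow_lt; lra).
assert (HPI := PI_4); assert (HPI0 := PI2_1).
assert (Hm5 : 32 <= m ^ 5) by (replace 32 with (2 ^ 5) by ring; apply pow_incr; lra).
assert (HYm : 20 <= Y * / (2 * m) * Y).
{ rewrite HY; replace (m ^ 6 * / (2 * m) * m ^ 6) with (m ^ 5 * m ^ 5 * m / 2) by (field; lra).
  nra. }
assert (Hexp : exp (- (Y * g) ^ 2 / 4) <= exp (- (5 * g))).
{ assert (H : - (Y * g) ^ 2 / 4 <= - (5 * g)).
  { assert (/ (2 * m) * (Y * Y) <= g * (Y * Y)) by (apply Rmult_le_compat_r; nra).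
    assert (20 * g <= g * (Y * Y) * g) by (apply Rmult_le_compat_r; lra).
    simpl; lra. }
  destruct (Rle_lt_or_eq_dec _ _ H) as [h|h]; [left; now apply exp_increasing|rewrite h; lra]. }
assert (Hinv : / (Y * g) <= 2 * m / Y).
{ replace (2 * m / Y) with (/ (Y * / (2 * m))) by (field; lra).
  apply Rinv_le_contravar; [now apply Rmult_lt_0_compat|].
  apply Rmult_le_compat_l; lra. }
assert (0 < / (Y * g)) by (apply Rinv_0_lt_compat, Rmult_lt_0_compat; lra).
pose proof (exp_pos (- (5 * g))) as He; pose proof (exp_pos (- (Y * g) ^ 2 / 4)) as He2.
replace (11 * m / Y * exp (- (5 * g))) with (11 / 2 * exp (- (5 * g)) * (2 * m / Y)) by (field; lra).
change (4 * PI / 3 * exp (- (Y * g) ^ 2 / 4) * / (Y * g)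
  <= 11 / 2 * exp (- (5 * g)) * (2 * m / Y)).
apply Rmult_le_compat; [|lra| |easy].
- apply Rmult_le_pos; lra.
- apply Rmult_le_compat; lra.
Qed.

Lemma sum_inv_sq_le (N : nat) : sum_f_R0 (fun k => / INR (S k) ^ 2) N <= 2 - / INR (S N).
Proof.
induction N as [|N IH]; [simpl; lra|].
rewrite tech5; rewrite (S_INR (S N)); pose proof (INR_S_pos N) as HN.
set (n := INR (S N)) in *.
assert (/ (n + 1) ^ 2 <= / n - / (n + 1)); [|lra].
replace (/ n - / (n + 1)) with (/ (n * (n + 1))) by (field; lra).
apply Rinv_le_contravar; nra.
Qed.

Lemma ln_le_sub_1 (x : R) : 0 < x -> ln x <= x - 1.
Proof.
intros Hx; pose proof (exp_ineq1_le (ln x)) as H; rewrite exp_ln in H by easy; lra.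
Qed.

(* The coefficients may grow polynomially because the error of the cutoff decays
   like a large power of the index. *)
Lemma trig_sum_partial (b : nat -> C) (N M r : nat) (B B' m Y : R) :
  (M <= N)%nat -> (1 <= r)%nat -> m = INR (S (S M)) -> Y = m ^ 6 ->
  Y * (lam N + lam (S M)) <= INR r -> 0 <= B -> 0 <= B' ->
  (forall u, Rabs u <= 4 * INR r * Y -> Cmod (psum (fun k => b k * cis (u * lam k))%C N) <= B) ->
  (forall k, Cmod (b k) <= INR (S k) ^ 3 * B') ->
  Cmod (psum b M) <= (3 + 18 * ln m) * B + 22 * B'.
Proof.
intros HMN Hr Hm HY HrY HB0 HB0' HB Hb.
assert (Hr1 : 1 <= INR r) by (apply (le_INR 1); easy).
assert (Hm2 : 2 <= m) by (rewrite Hm, !S_INR; pose proof (pos_INR M); lra).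
assert (HY0 : 0 < Y) by (rewrite HY; apply pow_lt; lra).
assert (HlM := lam_pos M); assert (HlN := lam_le M N HMN).
assert (HlM1 := lam_lt M (S M) (Nat.lt_succ_diag_r M)).
(* The midpoint of two consecutive frequencies: every [lam k] stays at distance at least [g0] from
   the edge. *)
set (L := (lam M + lam (S M)) / 2).
assert (HL0 : 0 <= L) by (unfold L; lra).
assert (HLm : L <= ln m) by (rewrite Hm; change (L <= lam (S M)); unfold L; lra).
set (g0 := (lam (S M) - lam M) / 2).
assert (Hg0 : / (2 * m) <= g0).
{ pose proof (ln_incr_lower (INR (S M)) m (INR_S_pos M) ltac:(lra)) as H.
  rewrite Hm in H at 1; rewrite (S_INR (S M)) in H.
  replace (ln m) with (lam (S M)) in H by (unfold lam; now rewrite Hm).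
  change (ln (INR (S M))) with (lam M) in H; unfold g0.
  replace (/ (2 * m)) with (/ 2 * ((INR (S M) + 1 - INR (S M)) / m)) by (field; lra); lra. }
assert (Hg00 : 0 < g0) by (unfold g0; lra).
(* The kernel width is fixed by [r * d = Y]; the lower bound on [r] then makes [d] small enough for
   the whole range of frequencies up to [lam N]. *)
set (d := Y / INR r).
assert (Hd : 0 < d) by (apply Rdiv_lt_0_compat; lra).
assert (Hrd : INR r * d = Y) by (unfold d; field; lra).
assert (Hd1 : forall k, (k <= N)%nat -> d * (lam k + L) <= 1).
{ intros k Hk; apply Rmult_le_reg_l with (INR r); [lra|].
  rewrite <- Rmult_assoc, Hrd, Rmult_1_r.
  apply Rle_trans with (Y * (lam N + lam (S M))); [|easy].
  pose proof (lam_le k N Hk); apply Rmult_le_compat_l; unfold L; lra. }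
assert (HT : Cmod (psum (fun k => RtoC (cutoff r d L (lam k)) * b k)%C N)
  <= (3 + 18 * ln m) * B).
{ eapply Rle_trans; [apply (trig_sum_cutoff b N r B d L Hr Hd HL0)|].
  - specialize (Hd1 O ltac:(lia)); rewrite lam_0 in Hd1; lra.
  - easy.
  - intros u Hu; apply HB; rewrite mult_INR in Hu.
    replace (4 * INR r * Y) with (4 * (INR r * INR r) * d); [easy|].
    rewrite <- Hrd; ring.
  - apply Rmult_le_compat_r; [easy|].
    replace (2 * INR r * d * L) with (2 * Y * L) by (rewrite <- Hrd; ring).
    (* The 18 of the statement is twice this exponent 9. *)
    assert (H9 : 1 + 2 * Y * L <= m ^ 9).
    { assert (HLm1 : L <= m) by (pose proof (ln_le_sub_1 m ltac:(lra)); lra).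
      assert (1 <= m ^ 6) by (apply pow_R1_Rle; lra).
      assert (HYL : Y * L <= m ^ 6 * m) by (rewrite HY; apply Rmult_le_compat_l; lra).
      assert (0 <= m ^ 6 * ((m - 2) * (m ^ 2 + 2 * m + 2))) by (repeat apply Rmult_le_pos; nra).
      replace (m ^ 9) with (m ^ 6 * m ^ 3) by ring; nra. }
    assert (ln (1 + 2 * Y * L) <= 9 * ln m); [|lra].
    apply Rle_trans with (ln (m ^ 9)).
    + apply ln_le; [|easy]; assert (0 <= 2 * Y * L) by (repeat apply Rmult_le_pos; lra); lra.
    + rewrite ln_pow by lra; simpl INR; lra. }
set (D := fun k => if Nat.leb k M then b k else RtoC 0).
assert (HD : psum D N = psum b M).
{ clear -HMN; induction HMN as [|N HMN IH].
  - apply psum_ext; intros k Hk; unfold D; now rewrite (proj2 (Nat.leb_le k M) Hk).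
  - rewrite psum_S, IH; unfold D at 1.
    rewrite (proj2 (Nat.leb_gt (S N) M)) by lia; ring. }
rewrite <- HD.
set (T := fun k => (RtoC (cutoff r d L (lam k)) * b k)%C) in *.
replace (psum D N) with (psum T N - psum (fun k => T k - D k)%C N)%C by (rewrite psum_minus; ring).
eapply Rle_trans; [apply Cmod_triangle|]; rewrite Cmod_opp.
apply Rplus_le_compat; [exact HT|].
(* The choice [Y = m ^ 6] cancels [m * m ^ 5], and the coefficient bound turns the fifth power of
   the index into a square. As the inverse squares sum to at most 2, the total error is
   [22 * B']. *)
assert (Herr : forall k e, Rabs e <= 11 * m / Y * (m ^ 5 / INR (S k) ^ 5) ->
  Cmod (RtoC e * b k) <= / INR (S k) ^ 2 * (11 * B')).
{ intros k e He; pose proof (INR_S_pos k) as Hk.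
  rewrite Cmod_mult, Cmod_R.
  apply Rle_trans with (11 * m / Y * (m ^ 5 / INR (S k) ^ 5) * (INR (S k) ^ 3 * B')).
  - apply Rmult_le_compat; [apply Rabs_pos|apply Cmod_ge_0|easy|apply Hb].
  - right; rewrite HY; field; lra. }
apply Rle_trans with (sum_f_R0 (fun k => / INR (S k) ^ 2 * (11 * B')) N).
- apply Cmod_psum_le; intros k Hk; unfold T, D.
  pose proof (INR_S_pos k) as Hk0.
  destruct (Nat.leb_spec k M) as [h|h].
  + replace (cutoff r d L (lam k) * b k - b k)%C with (RtoC (cutoff r d L (lam k) - 1) * b k)%C
      by (rewrite RtoC_minus; ring).
    apply Herr.
    pose proof (lam_pos k); pose proof (lam_le k M h).
    eapply Rle_trans; [apply (cutoff_inside r d L (lam k) g0); try easy|].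
    * unfold L, g0; lra.
    * now apply Hd1.
    * rewrite <- Rmult_assoc, Hrd.
      eapply Rle_trans; [apply (cutoff_error_bound m Y g0 g0); lra|].
      apply Rmult_le_compat_l; [left; apply Rdiv_lt_0_compat; lra|].
      apply Rle_trans with 1.
      -- rewrite <- exp_0; left; apply exp_increasing; lra.
      -- apply Rmult_le_reg_r with (INR (S k) ^ 5); [now apply pow_lt|].
         unfold Rdiv; rewrite Rmult_assoc, Rinv_l, Rmult_1_l, Rmult_1_r
           by (apply pow_nonzero; lra).
         apply pow_incr; split; [lra|]; rewrite Hm; apply le_INR; lia.
  + replace (cutoff r d L (lam k) * b k - 0)%C with (RtoC (cutoff r d L (lam k)) * b k)%C by ring.
    apply Herr.
    pose proof (lam_le (S M) k h) as Hlk.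
    eapply Rle_trans; [apply (cutoff_outside r d L (lam k) (lam k - L)); try easy|].
    * unfold L; lra.
    * lra.
    * now apply Hd1.
    * rewrite <- Rmult_assoc, Hrd.
      eapply Rle_trans; [apply (cutoff_error_bound m Y g0); try lra; unfold L, g0; lra|].
      apply Rmult_le_compat_l; [left; apply Rdiv_lt_0_compat; lra|].
      replace (- (5 * (lam k - L))) with (5 * L + - (5 * lam k)) by ring.
      rewrite exp_plus, exp_Ropp.
      assert (H5 : forall x, exp (5 * x) = exp x ^ 5).
      { intros x; replace (5 * x) with (x + x + x + x + x) by ring; rewrite !exp_plus; ring. }
      rewrite !H5, exp_lam; apply Rmult_le_compat_r.
      -- left; now apply Rinv_0_lt_compat, pow_lt.
      -- apply pow_incr; split; [left; apply exp_pos|].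
         rewrite <- (exp_ln m) by lra.
         destruct (Rle_lt_or_eq_dec _ _ HLm) as [h'|h']; [left; now apply exp_increasing|rewrite h'; lra].
- rewrite <- scal_sum.
  pose proof (sum_inv_sq_le N) as H; pose proof (INR_S_pos N).
  assert (0 < / INR (S N)) by now apply Rinv_0_lt_compat.
  nra.
Qed.

Lemma exp_le (x y : R) : x <= y -> exp x <= exp y.
Proof.
intros H; destruct (Rle_lt_or_eq_dec _ _ H) as [h|h]; [left; now apply exp_increasing|rewrite h; lra].
Qed.

(** The affine factor is the shape of the tail bound at the heights in use, which grow like [lam N].
    Half of the exponent absorbs it. *)
Lemma affine_exp_decay (p q c e : R) : 0 <= p -> 0 <= q -> 0 < c -> 0 < e ->
  exists N0, forall N, (N0 <= N)%nat -> (p + q * lam N) * exp (- c * lam N) <= e.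
Proof.
intros Hp Hq Hc He.
set (K := (p + 2 * q / c) / e).
destruct (INR_unbounded (exp (2 * (Rmax K 1 - 1) / c))) as [N0 HN0].
exists N0; intros N HN.
assert (Hl : 2 * (Rmax K 1 - 1) / c <= lam N).
{ rewrite <- (ln_exp (2 * (Rmax K 1 - 1) / c)); apply ln_le; [apply exp_pos|].
  apply Rle_trans with (INR N0); [lra|apply le_INR; lia]. }
assert (HlN := lam_pos N).
assert (Hcl : 0 <= c * lam N) by nra.
replace (- c * lam N) with (- (c / 2 * lam N) + - (c / 2 * lam N)) by field.
rewrite exp_plus, exp_Ropp.
pose proof (exp_ineq1_le (c / 2 * lam N)) as H1; set (X := exp (c / 2 * lam N)) in *.
assert (HX : 1 <= X) by lra.
assert (HKX : K <= X).
{ assert (Rmax K 1 - 1 <= c / 2 * lam N).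
  { apply Rmult_le_reg_l with (2 / c); [apply Rdiv_lt_0_compat; lra|].
    replace (2 / c * (c / 2 * lam N)) with (lam N) by (field; lra).
    replace (2 / c * (Rmax K 1 - 1)) with (2 * (Rmax K 1 - 1) / c) by (field; lra); lra. }
  pose proof (Rmax_l K 1); lra. }
assert (Hlin : p + q * lam N <= (p + 2 * q / c) * X).
{ assert (lam N <= 2 / c * X).
  { apply Rmult_le_reg_l with (c / 2); [lra|].
    replace (c / 2 * (2 / c * X)) with X by (field; lra); lra. }
  replace ((p + 2 * q / c) * X) with (p * X + q * (2 / c * X)) by (field; lra); nra. }
assert (HeK : p + 2 * q / c <= e * X).
{ replace (p + 2 * q / c) with (e * K) by (unfold K; field; lra).
  apply Rmult_le_compat_l; lra. }
assert (HiX : 0 < / X) by (apply Rinv_0_lt_compat; lra).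
apply Rle_trans with (e * X * X * (/ X * / X)).
- apply Rmult_le_compat_r; [nra|]; nra.
- right; field; lra.
Qed.

Lemma bounded_by_ge_0 (B : R) (f : C0 -> C) : bounded_by B f -> 0 <= B.
Proof.
intros HB; assert (H : 0 < Re (1, 0)) by (simpl; lra).
pose proof (HB (exist _ (1, 0) H)); pose proof (Cmod_ge_0 (f (exist _ (1, 0) H))); lra.
Qed.

(** With [M] fixed, [N] is taken so large that [S_N f] is bounded by [B + e1] at all heights the
    cutoff uses; [trig_sum_partial] then applies with a constant in which [N] does not appear. The
    25 is [3 + 22]. *)
Lemma dirichlet_partial_sum_bound (a : nat -> C) (f : C0 -> C) (B : R) :
  is_dirichlet_series a f -> bounded_by B f ->
  forall (s : C) (M : nat), 0 < Re s ->
  Cmod (psum (dterm a s) M) <= (25 + 18 * ln (INR (S (S M)))) * B.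
Proof.
intros Ha HB [sigma t] M Hs; simpl in Hs.
assert (HB0 := bounded_by_ge_0 B f HB).
destruct (dirichlet_tail_growth a f sigma t Ha Hs) as [A [HA HAt]].
set (m := INR (S (S M))); set (Y := m ^ 6).
assert (Hm2 : 2 <= m) by (unfold m; rewrite !S_INR; pose proof (pos_INR M); lra).
assert (Hlnm : 0 <= ln m) by (rewrite <- ln_1; apply ln_le; lra).
assert (HY0 : 0 < Y) by (apply pow_lt; lra).
assert (Hlam := lam_pos (S M)).
apply le_epsilon; intros e He.
set (e1 := e / (3 + 18 * ln m)).
assert (He1 : 0 < e1) by (apply Rdiv_lt_0_compat; lra).
destruct (affine_exp_decay (A * (1 + 4 * Y * (Y * lam (S M) + 2))) (A * (4 * Y * Y))
  (sigma / 2) e1) as [N0 HN0]; [| |lra|easy|].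
{ apply Rmult_le_pos; [easy|]; assert (0 <= Y * lam (S M)) by nra; nra. }
{ apply Rmult_le_pos; [easy|]; nra. }
set (N := max N0 M); specialize (HN0 N ltac:(lia)).
assert (HlN := lam_pos N).
(* The lower bound makes the period long enough; the upper bound keeps the heights [4 * INR r * Y]
   affine in [lam N], so that [HN0] controls the tail. *)
assert (Hr : exists r, (1 <= r)%nat /\ Y * (lam N + lam (S M)) <= INR r
  /\ INR r <= Y * (lam N + lam (S M)) + 2).
{ assert (Hpos : 0 <= Y * (lam N + lam (S M))) by (apply Rmult_le_pos; lra).
  destruct (nfloor_ex _ Hpos) as [n [Hn1 Hn2]].
  exists (S n); rewrite S_INR; split; [lia|]; lra. }
destruct Hr as [r [Hr1 [Hr2 Hr3]]].
assert (Hgoal : Cmod (psum (dterm a (sigma, t)) M) <= (3 + 18 * ln m) * (B + e1) + 22 * B).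
{ apply (trig_sum_partial _ N M r (B + e1) B m Y); try easy; try lia; try lra.
  - intros u Hu.
    assert (Hpt : 0 < Re (sigma, t + - u)) by exact Hs.
    rewrite (psum_ext _ (dterm a (sigma, t + - u))).
    2:{ intros k _; unfold dterm; rewrite !n_pow_opp_S; simpl Re; simpl Im.
        replace (- (t + - u) * lam k) with (- t * lam k + u * lam k) by ring.
        rewrite cis_plus; ring. }
    pose proof (HAt (- u) N Hpt) as Ht; pose proof (HB (exist _ (sigma, t + - u) Hpt)) as Hf.
    set (z := f _) in *; set (P := psum _ N) in *.
    replace P with (z + - (z - P))%C by ring.
    eapply Rle_trans; [apply Cmod_triangle|]; rewrite Cmod_opp.
    apply Rplus_le_compat; [easy|].
    eapply Rle_trans; [exact Ht|]; eapply Rle_trans; [|exact HN0].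
    apply Rmult_le_compat_r; [left; apply exp_pos|].
    rewrite Rabs_Ropp.
    replace (A * (1 + 4 * Y * (Y * lam (S M) + 2)) + A * (4 * Y * Y) * lam N)
      with (A * (1 + 4 * (Y * (lam N + lam (S M)) + 2) * Y)) by ring.
    apply Rmult_le_compat_l; [easy|].
    assert (INR r * Y <= (Y * (lam N + lam (S M)) + 2) * Y) by (apply Rmult_le_compat_r; lra).
    lra.
  - intros k; unfold dterm; rewrite Cmod_mult, Cmod_n_pow_opp; simpl Re.
    pose proof (dirichlet_coef_bound a f B Ha HB k).
    assert (exp (- sigma * lam k) <= 1).
    { rewrite <- exp_0; apply exp_le; pose proof (lam_pos k); nra. }
    pose proof (exp_pos (- sigma * lam k)); pose proof (Cmod_ge_0 (a (S k))); nra. }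
replace ((3 + 18 * ln m) * (B + e1) + 22 * B)
  with ((25 + 18 * ln m) * B + e) in Hgoal by (unfold e1; field; lra).
exact Hgoal.
Qed.

(** * Uniform limits *)

(** The bound [25 + 18 ln (k + 2)] is at most [43 + 18 lam k], hence at most
    [(43 + 72 / eps) exp (eps / 4 * lam k)]. The factor 3 comes from Abel summation: 2 for the
    variation and 1 for a boundary term. *)
Definition tail_bound (eps : R) (N : nat) : R :=
  3 * (43 + 72 / eps) * exp (- (eps / 4) * lam N).

Lemma tail_bound_pos (eps : R) (N : nat) : 0 < eps -> 0 <= tail_bound eps N.
Proof.
intros He; apply Rmult_le_pos; [|left; apply exp_pos].
assert (0 < 72 / eps) by (apply Rdiv_lt_0_compat; lra); lra.
Qed.

Lemma tail_bound_small (eps e : R) : 0 < eps -> 0 < e ->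
  exists N0, forall N, (N0 <= N)%nat -> tail_bound eps N <= e.
Proof.
intros Heps He.
assert (0 < 72 / eps) by (apply Rdiv_lt_0_compat; lra).
destruct (affine_exp_decay (3 * (43 + 72 / eps)) 0 (eps / 4) e) as [N0 HN0]; try lra.
exists N0; intros N HN; specialize (HN0 N HN).
now rewrite Rmult_0_l, Rplus_0_r in HN0.
Qed.

(** Half of [eps] is split off as a real shift, so [s0] remains in the half-plane and the weights
    are positive and decreasing: no factor depends on the height. The weights are [y k * y k], one
    factor of which pays for the logarithmic growth of the partial sums at [s0]. *)
Lemma dirichlet_uniform_tail (a : nat -> C) (f : C0 -> C) (B eps : R) :
  is_dirichlet_series a f -> bounded_by B f -> 0 < eps ->
  forall (s : C0) (N : nat), eps <= Re (proj1_sig s) ->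
  Cmod (f s - psum (dterm a (proj1_sig s)) N) <= tail_bound eps N * B.
Proof.
intros Ha HB Heps s N Hs.
assert (HB0 := bounded_by_ge_0 B f HB).
apply (Cmod_limit_le _ _ _ _ N (Ha s)); intros n Hn.
fold (dterm a (proj1_sig s)).
set (s0 := (Re (proj1_sig s) - eps / 2, Im (proj1_sig s)) : C).
set (t0 := (eps / 2, 0) : C).
assert (E : proj1_sig s = (s0 + t0)%C).
{ unfold s0, t0, Cplus; simpl; destruct (proj1_sig s); simpl; f_equal; field. }
assert (Hs0 : 0 < Re s0) by (simpl; lra).
rewrite E, !(psum_ext (dterm a (_ + _)) _ _ (fun k _ => dterm_plus a s0 t0 k)).
set (c := eps / 4); set (y := fun k => exp (- c * lam k)).
set (A := (43 + 72 / eps) * B).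
assert (Hc : 0 < c) by (unfold c; lra).
assert (Hy : forall k, 0 < y k) by (intros; apply exp_pos).
assert (H72 : 0 < 72 / eps) by (apply Rdiv_lt_0_compat; lra).
assert (HA : 0 <= A) by (apply Rmult_le_pos; lra).
assert (HX : forall k, Cmod (psum (dterm a s0) k) <= A * / y k).
{ intros k; eapply Rle_trans; [apply (dirichlet_partial_sum_bound a f B Ha HB s0 k Hs0)|].
  unfold y; replace (- c * lam k) with (- (c * lam k)) by ring.
  rewrite exp_Ropp, Rinv_inv; unfold A.
  pose proof (lam_pos k) as Hl.
  assert (Hln : ln (INR (S (S k))) <= 1 + lam k).
  { apply Rle_trans with (ln (2 * INR (S k))).
    - apply ln_le; [apply INR_S_pos|].
      rewrite (S_INR (S k)); pose proof (pos_INR k); rewrite S_INR; lra.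
    - rewrite ln_mult; [|lra|apply INR_S_pos]; fold (lam k).
      pose proof (ln_le_sub_1 2 ltac:(lra)); lra. }
  assert (Hcl : 0 <= c * lam k) by nra.
  pose proof (exp_ineq1_le (c * lam k)) as He.
  assert (18 * lam k <= 72 / eps * exp (c * lam k)).
  { replace (18 * lam k) with (72 / eps * (c * lam k)) by (unfold c; field; lra).
    apply Rmult_le_compat_l; lra. }
  apply Rle_trans with ((43 + 72 / eps) * exp (c * lam k) * B); [|right; ring].
  apply Rmult_le_compat_r; [easy|]; nra. }
assert (Hw : forall k, n_pow_opp (S k) t0 = RtoC (y k * y k)).
{ intros k; unfold t0; rewrite n_pow_opp_S; simpl Re; simpl Im.
  rewrite Ropp_0, Rmult_0_l, cis_0; unfold y; rewrite <- exp_plus.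
  replace (- c * lam k + - c * lam k) with (- (eps / 2) * lam k) by (unfold c; field); ring. }
assert (Hdec : forall k, y (S k) <= y k).
{ intros k; apply exp_le; pose proof (lam_le k (S k) (Nat.le_succ_diag_r k)); nra. }
rewrite !(psum_ext (fun k => _ * n_pow_opp (S k) _)%C
  (fun k => dterm a s0 k * RtoC (y k * y k)%R)%C) by (intros k _; now rewrite Hw).
(* The majorant comes from [y^2 - y'^2 <= 2 y (y - y')] for consecutive values, divided by the [y]
   in the bound [A / y]. *)
eapply Rle_trans; [apply (abel_summation _ _ (fun k => 2 * A * y k)); [|exact Hn]|].
- intros k; rewrite <- RtoC_minus, Cmod_R.
  pose proof (Hy k); pose proof (Hy (S k)); specialize (Hdec k).
  rewrite Rabs_right by nra.
  apply Rle_trans with (A * / y k * (y k * y k - y (S k) * y (S k))).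
  + apply Rmult_le_compat_r; [nra|apply HX].
  + apply Rle_trans with (A * / y k * (2 * y k * (y k - y (S k)))).
    * apply Rmult_le_compat_l; [|nra].
      apply Rmult_le_pos; [easy|left; now apply Rinv_0_lt_compat].
    * right; field; lra.
- assert (HXw : forall k, Cmod (psum (dterm a s0) k) * Cmod (RtoC (y k * y k)) <= A * y k).
  { intros k; pose proof (Hy k); rewrite Cmod_R, Rabs_right by nra.
    apply Rle_trans with (A * / y k * (y k * y k)).
    - apply Rmult_le_compat_r; [nra|apply HX].
    - right; field; lra. }
  assert (HyN : y n <= y N).
  { apply exp_le; pose proof (lam_le N n Hn); nra. }
  pose proof (HXw n); pose proof (HXw N); pose proof (Hy n).
  replace (tail_bound eps N * B) with (3 * A * y N) by (unfold tail_bound, A, y, c; ring).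
  nra.
Qed.

Lemma le_of_le_inv_nat (x y K : R) : (forall k, x <= y + K / INR (S k)) -> x <= y.
Proof.
intros H; apply le_epsilon; intros e He.
destruct (INR_unbounded (Rabs K / e)) as [n Hn].
eapply Rle_trans; [apply (H n)|]; apply Rplus_le_compat_l.
pose proof (INR_S_pos n) as Hp.
apply Rmult_le_reg_r with (INR (S n)); [easy|].
unfold Rdiv; rewrite Rmult_assoc, Rinv_l, Rmult_1_r by lra.
rewrite S_INR in *; pose proof (Rle_abs K).
assert (Rabs K = e * (Rabs K / e)) by (field; lra); nra.
Qed.

(** The explicit rate passes to the limit, which serves both for coefficients, where [K] depends on
    the index, and for values of functions, where it is uniform in the point. *)
Lemma C_cauchy_limit (z : nat -> C) (K : R) :
  (forall n k, Cmod (z n - z k) <= K * (/ INR (S n) + / INR (S k))) ->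
  exists l, forall n, Cmod (z n - l) <= K / INR (S n).
Proof.
intros Hz.
assert (Hcv : forall p : C -> R, (forall x y, Rabs (p x - p y) <= Cmod (x - y)) ->
  exists l, is_lim_seq (fun n => p (z n)) (Finite l)).
{ intros p Hp.
  assert (Hex : ex_finite_lim_seq (fun n => p (z n))); [|destruct Hex as [l Hl]; now exists l].
  apply ex_lim_seq_cauchy_corr; intros e.
  assert (He := cond_pos e); destruct (INR_unbounded (2 * Rabs K / e)) as [N HN].
  exists N; intros n m Hn Hm; eapply Rle_lt_trans; [apply Hp|].
  eapply Rle_lt_trans; [apply Hz|].
  assert (HNp : 0 < INR (S N)) by apply INR_S_pos.
  assert (Hin : forall q, (N <= q)%nat -> 0 < / INR (S q) <= / INR (S N)).
  { intros q Hq; split; [apply Rinv_0_lt_compat, INR_S_pos|].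
    apply Rinv_le_contravar; [easy|apply le_INR; lia]. }
  pose proof (Hin n Hn) as H1; pose proof (Hin m Hm) as H2.
  apply Rle_lt_trans with (Rabs K * (2 * / INR (S N))).
  - pose proof (Rle_abs K); pose proof (Rabs_pos K).
    apply Rle_trans with (Rabs K * (/ INR (S n) + / INR (S m))).
    + apply Rmult_le_compat_r; lra.
    + apply Rmult_le_compat_l; lra.
  - apply Rmult_lt_reg_r with (INR (S N)); [easy|].
    rewrite Rmult_assoc, (Rmult_assoc 2), Rinv_l, Rmult_1_r by lra.
    rewrite S_INR; assert (2 * Rabs K = e * (2 * Rabs K / e)) by (field; lra); nra. }
destruct (Hcv Re) as [a Ha].
{ intros x y; replace (Re x - Re y) with (Re (x - y)%C) by (destruct x, y; reflexivity).
  apply re_le_Cmod. }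
destruct (Hcv Im) as [b Hb].
{ intros x y; replace (Im x - Im y) with (Im (x - y)%C) by (destruct x, y; reflexivity).
  eapply Rle_trans; [|apply Rmax_Cmod]; apply Rmax_r. }
exists (a, b); intros n; apply le_of_le_inv_nat with (K := K + 2); intros k.
apply le_epsilon; intros e He.
assert (Hek : 0 < / INR (S k)) by apply Rinv_0_lt_compat, INR_S_pos.
apply is_lim_seq_spec in Ha; apply is_lim_seq_spec in Hb.
destruct (Ha (mkposreal _ Hek)) as [N1 HN1]; destruct (Hb (mkposreal _ Hek)) as [N2 HN2].
cbn [pos] in HN1, HN2.
set (q := max k (max N1 N2)).
specialize (HN1 q ltac:(lia)); specialize (HN2 q ltac:(lia)).
replace (z n - (a, b))%C with ((z n - z q) + (z q - (a, b)))%C by ring.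
eapply Rle_trans; [apply Cmod_triangle|].
assert (H2 : Cmod (z q - (a, b)) <= 2 * / INR (S k)).
{ replace (z q - (a, b))%C with (RtoC (Re (z q) - a) + Ci * RtoC (Im (z q) - b))%C.
  - eapply Rle_trans; [apply Cmod_triangle|].
    rewrite Cmod_mult, Cmod_Ci, !Cmod_R; lra.
  - destruct (z q) as [u v]; unfold Cminus, Cplus, Copp, Cmult, Ci, RtoC; simpl; f_equal; ring. }
specialize (Hz n q).
assert (Hq : / INR (S q) <= / INR (S k)).
{ apply Rinv_le_contravar; [apply INR_S_pos|apply le_INR; lia]. }
assert (Hq0 : 0 < / INR (S q)) by apply Rinv_0_lt_compat, INR_S_pos.
assert (HK : 0 <= K).
{ pose proof (Cmod_ge_0 (z n - z q)).
  assert (0 < / INR (S n)) by apply Rinv_0_lt_compat, INR_S_pos; nra. }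
unfold Rdiv; nra.
Qed.

(** * Linear operations on Dirichlet series, and membership in [HinfS] *)

Lemma is_dirichlet_series_plus (a b : nat -> C) (f g : C0 -> C) :
  is_dirichlet_series a f -> is_dirichlet_series b g ->
  is_dirichlet_series (fun n => a n + b n)%C (fun_plus f g).
Proof.
intros Ha Hb s.
eapply is_series_ext; [|exact (is_series_plus _ _ _ _ (Ha s) (Hb s))].
intros n; symmetry; apply Cmult_plus_distr_r.
Qed.

Lemma is_dirichlet_series_scal (c : C) (a : nat -> C) (f : C0 -> C) :
  is_dirichlet_series a f ->
  is_dirichlet_series (fun n => c * a n)%C (fun_scal c f).
Proof.
intros Ha s.
eapply is_series_ext; [|exact (is_series_scal c _ _ (Ha s))].
intros n; apply Cmult_assoc.
Qed.

Lemma is_dirichlet_series_ext (a b : nat -> C) (f g : C0 -> C) :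
  (forall n, a (S n) = b (S n)) -> (forall s, f s = g s) ->
  is_dirichlet_series a f -> is_dirichlet_series b g.
Proof.
intros Hab Hfg Ha s; rewrite <- Hfg.
eapply is_series_ext; [|exact (Ha s)].
intros n; simpl; now rewrite Hab.
Qed.

Lemma is_dirichlet_series_minus (a b : nat -> C) (f g : C0 -> C) :
  is_dirichlet_series a f -> is_dirichlet_series b g ->
  is_dirichlet_series (fun n => a n - b n)%C (fun s => f s - g s)%C.
Proof.
intros Ha Hb.
apply (is_dirichlet_series_scal (- (1))) in Hb.
eapply is_dirichlet_series_ext; [| |exact (is_dirichlet_series_plus _ _ _ _ Ha Hb)].
- intros n; simpl; ring.
- intros s; unfold fun_plus, fun_scal; ring.
Qed.

Lemma sup_norm_is_lub (f : C0 -> C) :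
  is_lub_Rbar (fun r => exists s, r = Cmod (f s)) (sup_norm f).
Proof. apply Lub_Rbar_correct. Qed.

Lemma sup_norm_bounded (f : C0 -> C) :
  Rbar_lt (sup_norm f) p_infty <-> exists B, bounded_by B f.
Proof.
destruct (sup_norm_is_lub f) as [Hub Hlub]; split.
- intros H; exists (real (sup_norm f)); intros s.
  specialize (Hub (Cmod (f s)) (ex_intro _ s eq_refl)).
  destruct (sup_norm f); simpl in *; easy.
- intros [B HB].
  assert (H : Rbar_le (sup_norm f) (Finite B)).
  { apply Hlub; intros r [s ->]; apply HB. }
  eapply Rbar_le_lt_trans; [exact H|easy].
Qed.

Lemma HinfS_intro (X : nat -> Prop) (a : nat -> C) (f : C0 -> C) (B : R) :
  is_dirichlet_series a f -> bounded_by B f ->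
  (forall n, (1 <= n)%nat -> ~ X n -> a n = RtoC 0) -> HinfS X f.
Proof.
intros Ha HB HX; split; [split|].
- now exists a.
- apply sup_norm_bounded; now exists B.
- now exists a.
Qed.

Lemma HinfS_elim (X : nat -> Prop) (f : C0 -> C) : HinfS X f ->
  exists a B, is_dirichlet_series a f /\ bounded_by B f /\
  forall n, (1 <= n)%nat -> ~ X n -> a n = RtoC 0.
Proof.
intros [[_ HB] [a [Ha HX]]]; apply sup_norm_bounded in HB; destruct HB as [B HB].
now exists a, B.
Qed.

(** Take [h n] within [1 / (n + 1)] of [f]. The coefficient bound for [h n - h k] makes the
    coefficients converge to some [c]. The differences [h 0 - h k] are bounded by 2, so their tails
    are small uniformly in [k]. Letting [k] tend to infinity at fixed [N] transfers this to
    [h 0 - f] and [c], and so the series of [c] converges to [f]. *)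
Lemma HinfS_uniform_limit (X : nat -> Prop) (f : C0 -> C) :
  (forall e, 0 < e -> exists h, HinfS X h /\ forall s, Cmod (f s - h s) <= e) ->
  HinfS X f.
Proof.
intros Hf.
assert (Hseq : forall n, exists p : (C0 -> C) * (nat -> C),
  (exists B, bounded_by B (fst p)) /\ is_dirichlet_series (snd p) (fst p) /\
  (forall n, (1 <= n)%nat -> ~ X n -> snd p n = RtoC 0) /\
  forall s, Cmod (f s - fst p s) <= / INR (S n)).
{ intros n; destruct (Hf (/ INR (S n))) as [h [Hh Hd]].
  { apply Rinv_0_lt_compat, INR_S_pos. }
  destruct (HinfS_elim X h Hh) as [a [B [Ha [HB HX]]]].
  exists (h, a); repeat split; try easy; now exists B. }
set (h := fun n => fst (proj1_sig (constructive_indefinite_description _ (Hseq n)))).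
set (a := fun n => snd (proj1_sig (constructive_indefinite_description _ (Hseq n)))).
assert (Hha : forall n, (exists B, bounded_by B (h n)) /\ is_dirichlet_series (a n) (h n) /\
  (forall k, (1 <= k)%nat -> ~ X k -> a n k = RtoC 0) /\
  forall s, Cmod (f s - h n s) <= / INR (S n)).
{ intros n; exact (proj2_sig (constructive_indefinite_description _ (Hseq n))). }
clearbody h a; clear Hseq.
assert (Hdiff : forall n k, bounded_by (/ INR (S n) + / INR (S k)) (fun s => h n s - h k s)%C).
{ intros n k s.
  destruct (Hha n) as [_ [_ [_ H1]]]; destruct (Hha k) as [_ [_ [_ H2]]].
  replace (h n s - h k s)%C with (- (f s - h n s) + (f s - h k s))%C by ring.
  eapply Rle_trans; [apply Cmod_triangle|]; rewrite Cmod_opp.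
  now apply Rplus_le_compat. }
assert (Hds : forall n k, is_dirichlet_series (fun i => a n i - a k i)%C (fun s => h n s - h k s)%C).
{ intros n k; apply is_dirichlet_series_minus; [apply (Hha n)|apply (Hha k)]. }
assert (Hlim : forall i, exists l, forall n, Cmod (a n (S i) - l) <= INR (S i) ^ 3 / INR (S n)).
{ intros i; apply C_cauchy_limit; intros n k.
  exact (dirichlet_coef_bound _ _ _ (Hds n k) (Hdiff n k) i). }
(* The value at 0 is a default; only positive indices occur in the series. *)
set (c := fun i => match i with O => RtoC 0
  | S j => proj1_sig (constructive_indefinite_description _ (Hlim j)) end).
assert (Hc : forall i n, Cmod (a n (S i) - c (S i)) <= INR (S i) ^ 3 / INR (S n)).
{ intros i; exact (proj2_sig (constructive_indefinite_description _ (Hlim i))). }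
destruct (Hha O) as [[B0 HB0] [Ha0 [_ Hf0]]].
apply (HinfS_intro X c f (B0 + 1)).
- intros s; set (z := proj1_sig s); assert (Hz : 0 < Re z) by exact (proj2_sig s).
  fold (dterm c z).
  (* For fixed [N] the partial sums of [a k] and [c] differ by at most [SN / (k + 1)], which
     vanishes as [k] grows. *)
  assert (Hcmp : forall N, Cmod (h O s - f s - (psum (dterm (a O) z) N - psum (dterm c z) N))
    <= tail_bound (Re z) N).
  { intros N; pose proof (tail_bound_pos (Re z) N Hz) as Ht.
    set (SN := sum_f_R0 (fun i => INR (S i) ^ 3) N).
    apply le_of_le_inv_nat with (K := tail_bound (Re z) N + 1 + SN); intros k.
    pose proof (dirichlet_uniform_tail _ _ _ (Re z) (Hds O k) (Hdiff O k) Hz s N (Rle_refl _)) as H1.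
    fold z in H1.
    destruct (Hha k) as [_ [_ [_ H2]]]; specialize (H2 s).
    assert (H3 : Cmod (psum (dterm (fun i => a k i - c i)%C z) N) <= SN * / INR (S k)).
    { unfold SN; rewrite Rmult_comm, scal_sum.
      apply Cmod_psum_le; intros i _; unfold dterm; rewrite Cmod_mult, Cmod_n_pow_opp.
      rewrite <- (Rmult_1_r (_ * / INR (S k))).
      apply Rmult_le_compat; [apply Cmod_ge_0|left; apply exp_pos|apply Hc|].
      rewrite <- exp_0; apply exp_le; pose proof (lam_pos i); nra. }
    assert (E : forall b b' : nat -> C, psum (dterm (fun i => b i - b' i)%C z) N
      = (psum (dterm b z) N - psum (dterm b' z) N)%C).
    { intros b b'; rewrite <- psum_minus; apply psum_ext; intros i _; unfold dterm; ring. }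
    rewrite E in H1, H3.
    set (p0 := psum (dterm (a O) z) N) in *; set (pk := psum (dterm (a k) z) N) in *.
    set (pc := psum (dterm c z) N) in *.
    replace (h O s - f s - (p0 - pc))%C
      with (h O s - h k s - (p0 - pk) + - (f s - h k s) + - (pk - pc))%C by ring.
    eapply Rle_trans; [apply Cmod_triangle|]; rewrite Cmod_opp.
    eapply Rle_trans; [apply Rplus_le_compat_r, Cmod_triangle|]; rewrite Cmod_opp.
    replace (INR 1) with 1 in H1 by easy; rewrite Rinv_1 in H1.
    unfold Rdiv; nra. }
  apply is_series_C; intros e He.
  assert (HB00 := bounded_by_ge_0 _ _ HB0).
  destruct (tail_bound_small (Re z) (e / (2 * (1 + B0))) Hz) as [N0 HN0].
  { apply Rdiv_lt_0_compat; lra. }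
  exists N0; intros N HN; specialize (HN0 N HN); specialize (Hcmp N).
  pose proof (dirichlet_uniform_tail _ _ _ (Re z) Ha0 HB0 Hz s N (Rle_refl _)) as H1.
  fold z in H1.
  set (p0 := psum (dterm (a O) z) N) in *; set (pc := psum (dterm c z) N) in *.
  replace (pc - f s)%C with (h O s - f s - (p0 - pc) + - (h O s - p0))%C by ring.
  eapply Rle_lt_trans; [apply Cmod_triangle|]; rewrite Cmod_opp.
  apply Rle_lt_trans with (tail_bound (Re z) N * (1 + B0)); [lra|].
  apply Rle_lt_trans with (e / (2 * (1 + B0)) * (1 + B0)).
  + apply Rmult_le_compat_r; lra.
  + replace (e / (2 * (1 + B0)) * (1 + B0)) with (e / 2) by (field; lra); lra.
- intros s; replace (f s) with (h O s + (f s - h O s))%C by ring.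
  eapply Rle_trans; [apply Cmod_triangle|].
  specialize (Hf0 s); replace (INR 1) with 1 in Hf0 by easy; rewrite Rinv_1 in Hf0.
  specialize (HB0 s); lra.
- intros [|i] Hi HXi; [easy|].
  apply Cmod_eq_0, Rle_antisym; [|apply Cmod_ge_0].
  apply le_of_le_inv_nat with (K := INR (S i) ^ 3); intros k; rewrite Rplus_0_l.
  destruct (Hha k) as [_ [_ [H0 _]]]; specialize (Hc i k).
  rewrite (H0 (S i) Hi HXi) in Hc.
  replace (RtoC 0 - c (S i))%C with (- c (S i))%C in Hc by ring.
  now rewrite Cmod_opp in Hc.
Qed.

(** * Products *)

(** The coefficient bound for the difference, with [B = 0]. *)
Lemma dirichlet_coef_unique (a b : nat -> C) (f : C0 -> C) :
  is_dirichlet_series a f -> is_dirichlet_series b f -> forall n, a (S n) = b (S n).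
Proof.
intros Ha Hb n.
assert (H0 : bounded_by 0 (fun s => f s - f s)%C).
{ intros s; replace (f s - f s)%C with (RtoC 0) by ring; rewrite Cmod_0; lra. }
pose proof (dirichlet_coef_bound _ _ _ (is_dirichlet_series_minus _ _ _ _ Ha Hb) H0 n) as H.
rewrite Rmult_0_r in H.
assert (E : (a (S n) - b (S n))%C = RtoC 0).
{ apply Cmod_eq_0, Rle_antisym; [easy|apply Cmod_ge_0]. }
replace (a (S n)) with (a (S n) - b (S n) + b (S n))%C by ring; rewrite E; ring.
Qed.

Definition monomial (n : nat) (s : C0) : C := n_pow_opp n (proj1_sig s).

Lemma monomial_dirichlet (n : nat) : (1 <= n)%nat ->
  is_dirichlet_series (fun k => if Nat.eqb k n then RtoC 1 else RtoC 0) (monomial n).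
Proof.
destruct n as [|n]; [lia|intros _ s]; apply is_series_C; intros e He.
exists n; intros m Hm.
rewrite (psum_ext _ (fun k => if Nat.eqb k n then monomial (S n) s else RtoC 0)).
- rewrite psum_delta by easy.
  replace (monomial (S n) s - monomial (S n) s)%C with (RtoC 0) by ring; now rewrite Cmod_0.
- intros k _; simpl Nat.eqb; unfold monomial.
  destruct (Nat.eqb_spec k n) as [->|_]; ring.
Qed.

Lemma monomial_bounded (n : nat) : (1 <= n)%nat -> bounded_by 1 (monomial n).
Proof.
destruct n as [|n]; [lia|intros _ s]; unfold monomial.
rewrite Cmod_n_pow_opp, <- exp_0; apply exp_le.
pose proof (proj2_sig s); pose proof (lam_pos n); simpl in *; nra.
Qed.

Lemma monomial_mult (m n : nat) (s : C0) : (1 <= m)%nat -> (1 <= n)%nat ->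
  monomial (m * n) s = (monomial m s * monomial n s)%C.
Proof.
intros Hm Hn; unfold monomial.
destruct m as [|m], n as [|n]; try lia.
destruct (Nat.lt_exists_pred 0 (S m * S n) ltac:(lia)) as [q [Eq _]].
rewrite Eq, !n_pow_opp_S.
assert (El : lam q = lam m + lam n).
{ unfold lam; rewrite <- Eq, mult_INR; apply ln_mult; apply INR_S_pos. }
rewrite El, !Rmult_plus_distr_l, exp_plus, cis_plus, RtoC_mult; ring.
Qed.

Lemma HinfS_monomial (X : nat -> Prop) (n : nat) : (1 <= n)%nat -> X n -> HinfS X (monomial n).
Proof.
intros Hn HX; apply (HinfS_intro X _ _ 1 (monomial_dirichlet n Hn) (monomial_bounded n Hn)).
intros k _ Hk; destruct (Nat.eqb_spec k n) as [->|_]; easy.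
Qed.

Lemma HinfS_plus (X : nat -> Prop) (f g : C0 -> C) :
  HinfS X f -> HinfS X g -> HinfS X (fun_plus f g).
Proof.
intros Hf Hg.
destruct (HinfS_elim X f Hf) as [a [A [Ha [HA HXa]]]].
destruct (HinfS_elim X g Hg) as [b [B [Hb [HB HXb]]]].
apply (HinfS_intro X _ _ (A + B) (is_dirichlet_series_plus _ _ _ _ Ha Hb)).
- intros s; eapply Rle_trans; [apply Cmod_triangle|]; now apply Rplus_le_compat.
- intros n Hn HX; rewrite HXa, HXb by easy; ring.
Qed.

Lemma HinfS_scal (X : nat -> Prop) (c : C) (f : C0 -> C) :
  HinfS X f -> HinfS X (fun_scal c f).
Proof.
intros Hf; destruct (HinfS_elim X f Hf) as [a [A [Ha [HA HXa]]]].
apply (HinfS_intro X _ _ (Cmod c * A) (is_dirichlet_series_scal c _ _ Ha)).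
- intros s; unfold fun_scal; rewrite Cmod_mult.
  apply Rmult_le_compat_l; [apply Cmod_ge_0|apply HA].
- intros n Hn HX; rewrite HXa by easy; ring.
Qed.

Lemma HinfS_zero (X : nat -> Prop) : HinfS X (fun _ => RtoC 0).
Proof.
apply (HinfS_intro X (fun _ => RtoC 0) _ 0).
- intros s; apply is_series_C; intros e He; exists O; intros n _.
  rewrite psum_zero by (intros; ring).
  replace (0 - 0)%C with (RtoC 0) by ring; now rewrite Cmod_0.
- intros s; rewrite Cmod_0; lra.
- easy.
Qed.

Lemma HinfS_psum (X : nat -> Prop) (h : nat -> C0 -> C) (N : nat) :
  (forall k, HinfS X (h k)) -> HinfS X (fun s => psum (fun k => h k s) N).
Proof.
intros Hh; induction N as [|N IH].
- replace (fun s => psum (fun k => h k s) 0) with (h O); [apply Hh|].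
  apply functional_extensionality; intros s; now rewrite psum_0.
- replace (fun s => psum (fun k => h k s) (S N))
    with (fun_plus (fun s => psum (fun k => h k s) N) (h (S N))).
  + now apply HinfS_plus.
  + apply functional_extensionality; intros s; now rewrite psum_S.
Qed.

(** * Shifts to the right and products *)

Lemma C0_eq (s t : C0) : proj1_sig s = proj1_sig t -> s = t.
Proof.
destruct s as [s Hs], t as [t Ht]; simpl; intros ->; f_equal; apply proof_irrelevance.
Qed.

Lemma Re_plus_R (z : C) (eps : R) : Re (z + RtoC eps) = Re z + eps.
Proof. now destruct z. Qed.

(** Transparent, so that the underlying complex number computes; only the positivity proof is
    sealed, and [C0_eq] ignores it. *)
Definition shift (eps : R) (Heps : 0 <= eps) (s : C0) : C0.
Proof.
exists (proj1_sig s + RtoC eps)%C.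
abstract (rewrite Re_plus_R; pose proof (proj2_sig s : 0 < Re (proj1_sig s)); lra).
Defined.

Lemma dirichlet_shift (a : nat -> C) (f : C0 -> C) (eps : R) (Heps : 0 <= eps) :
  is_dirichlet_series a f ->
  is_dirichlet_series (fun n => a n * n_pow_opp n (RtoC eps))%C (fun s => f (shift eps Heps s)).
Proof.
intros Ha s; eapply is_series_ext; [|exact (Ha (shift eps Heps s))].
intros n; change (proj1_sig (shift eps Heps s)) with (proj1_sig s + RtoC eps)%C.
cbv beta; rewrite n_pow_opp_plus.
match goal with |- ?x = ?y => change (@eq C x y) end; ring.
Qed.

(** The expanded product is a finite combination of the monomials of index [S k * S j]: either both
    factors lie in [X], hence so does their product, or a coefficient vanishes. The point [z] is
    absorbed into the coefficients. *)
Lemma HinfS_partial_products (X : nat -> Prop) (a b : nat -> C) (z : C) (N : nat) :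
  multiplicative_subsemigroup X ->
  (forall n, (1 <= n)%nat -> ~ X n -> a n = RtoC 0) ->
  (forall n, (1 <= n)%nat -> ~ X n -> b n = RtoC 0) ->
  HinfS X (fun s => psum (dterm a (proj1_sig s + z)) N * psum (dterm b (proj1_sig s + z)) N)%C.
Proof.
intros HX Ha Hb.
set (G := fun k j s =>
  (dterm a z k * dterm b z j * (monomial (S k) s * monomial (S j) s))%C).
replace (fun s : C0 => _)%C with (fun s => psum (fun k => psum (fun j => G k j s) N) N).
- apply HinfS_psum; intros k; apply HinfS_psum; intros j.
  destruct (classic (X (S k) /\ X (S j))) as [[Hk Hj]|Hn].
  + replace (G k j) with (fun_scal (dterm a z k * dterm b z j)%C (monomial (S k * S j))).
    * apply HinfS_scal, HinfS_monomial; [lia|now apply HX].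
    * apply functional_extensionality; intros s; unfold fun_scal, G.
      rewrite monomial_mult by lia; ring.
  + replace (G k j) with (fun _ : C0 => RtoC 0); [apply HinfS_zero|].
    apply functional_extensionality; intros s; unfold G, dterm.
    destruct (not_and_or _ _ Hn) as [h|h].
    * rewrite (Ha (S k)) by (lia || easy); ring.
    * rewrite (Hb (S j)) by (lia || easy); ring.
- apply functional_extensionality; intros s.
  assert (E : forall c, psum (dterm c (proj1_sig s + z)) N
    = psum (fun k => monomial (S k) s * dterm c z k)%C N).
  { intros c; apply psum_ext; intros k _; unfold dterm, monomial; rewrite n_pow_opp_plus; ring. }
  rewrite !E, Cmult_comm, <- psum_scal; apply psum_ext; intros k _.
  rewrite Cmult_comm, <- psum_scal; apply psum_ext; intros j _; unfold G; ring.
Qed.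

Lemma HinfS_mult_shift (X : nat -> Prop) (f g : C0 -> C) (eps : R) (Heps : 0 <= eps) :
  multiplicative_subsemigroup X -> 0 < eps -> HinfS X f -> HinfS X g ->
  HinfS X (fun s => fun_mult f g (shift eps Heps s)).
Proof.
intros HX Hp Hf Hg.
destruct (HinfS_elim X f Hf) as [a [A [Ha [HA HXa]]]].
destruct (HinfS_elim X g Hg) as [b [B [Hb [HB HXb]]]].
assert (HA0 := bounded_by_ge_0 A f HA); assert (HB0 := bounded_by_ge_0 B g HB).
apply HinfS_uniform_limit; intros e He.
assert (HAB : 0 <= A * B) by now apply Rmult_le_pos.
(* The error is at most [A * B * (2 * tau + tau^2)], hence at most [3 * A * B * tau] when
   [tau <= 1]; the added 1 keeps the denominator positive. *)
destruct (tail_bound_small eps (Rmin 1 (e / (1 + 3 * (A * B)))) Hp) as [N HN].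
{ apply Rmin_pos; [lra|apply Rdiv_lt_0_compat; lra]. }
specialize (HN N (le_n _)).
pose proof (Rmin_l 1 (e / (1 + 3 * (A * B)))) as Hm1.
pose proof (Rmin_r 1 (e / (1 + 3 * (A * B)))) as Hm2.
assert (Ht0 := tail_bound_pos eps N Hp); set (tau := tail_bound eps N) in *.
exists (fun s => psum (dterm a (proj1_sig s + RtoC eps)) N
  * psum (dterm b (proj1_sig s + RtoC eps)) N)%C.
split; [now apply HinfS_partial_products|].
intros s; set (t := shift eps Heps s).
assert (Ht : eps <= Re (proj1_sig t)) 
  by (unfold t, shift; cbn [proj1_sig]; rewrite Re_plus_R; pose proof (proj2_sig s : 0 < Re (proj1_sig s)); lra).
pose proof (dirichlet_uniform_tail a f A eps Ha HA Hp t N Ht) as H1.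
pose proof (dirichlet_uniform_tail b g B eps Hb HB Hp t N Ht) as H2.
change (proj1_sig t) with (proj1_sig s + RtoC eps)%C in H1, H2; fold tau in H1, H2.
set (P := psum (dterm a _) N) in *; set (Q := psum (dterm b _) N) in *.
unfold fun_mult.
replace (f t * g t - P * Q)%C
  with (f t * (g t - Q) + (g t - (g t - Q)) * (f t - P))%C by ring.
eapply Rle_trans; [apply Cmod_triangle|]; rewrite !Cmod_mult.
assert (HQ : Cmod (g t - (g t - Q)) <= B + tau * B).
{ eapply Rle_trans; [apply Cmod_triangle|]; rewrite Cmod_opp; specialize (HB t); lra. }
apply Rle_trans with (A * (tau * B) + (B + tau * B) * (tau * A)).
- apply Rplus_le_compat; apply Rmult_le_compat; try apply Cmod_ge_0; try easy; apply HA.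
- assert (Htau : tau <= e / (1 + 3 * (A * B))) by lra.
  apply Rle_trans with (tau * (1 + 3 * (A * B))).
  + assert (tau * tau <= tau) by nra; nra.
  + apply Rle_trans with (e / (1 + 3 * (A * B)) * (1 + 3 * (A * B))).
    * apply Rmult_le_compat_r; lra.
    * right; field; lra.
Qed.

(* The coefficients of the shifts of [f g] determine each other by uniqueness, so the
   expansions for [eps -> 0] glue together. *)
Lemma HinfS_mult (X : nat -> Prop) (f g : C0 -> C) :
  multiplicative_subsemigroup X -> HinfS X f -> HinfS X g -> HinfS X (fun_mult f g).
Proof.
intros HX Hf Hg.
assert (Hshift : forall eps (H : 0 <= eps), 0 < eps -> exists c,
  is_dirichlet_series c (fun s => fun_mult f g (shift eps H s)) /\
  forall n, (1 <= n)%nat -> ~ X n -> c n = RtoC 0).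
{ intros eps H Hp; exact (proj2 (HinfS_mult_shift X f g eps H HX Hp Hf Hg)). }
destruct (Hshift 1 Rle_0_1 Rlt_0_1) as [c [Hc HXc]].
destruct (HinfS_elim X f Hf) as [_ [A [_ [HA _]]]].
destruct (HinfS_elim X g Hg) as [_ [B [_ [HB _]]]].
(* The coefficients [c] belong to the shift by 1; the factor [n_pow_opp n (RtoC (-1))], which is
   [n], undoes it. *)
apply (HinfS_intro X (fun n => c n * n_pow_opp n (RtoC (-1)))%C _ (A * B)).
- intros s.
  (* Below 1, so that a further shift by [1 - eps] leads to the coefficients [c]; below [Re s], so
     that [s - eps] still lies in the half-plane. *)
  set (eps := Rmin (1 / 2) (Re (proj1_sig s) / 2)).
  assert (Hs := proj2_sig s); simpl in Hs.
  pose proof (Rmin_l (1 / 2) (Re (proj1_sig s) / 2)) as He1.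
  pose proof (Rmin_r (1 / 2) (Re (proj1_sig s) / 2)) as He2; fold eps in He1, He2.
  assert (Hp : 0 < eps) by (apply Rmin_pos; lra).
  assert (H0 : 0 <= eps) by lra; assert (H1 : 0 <= 1 - eps) by lra.
  destruct (Hshift eps H0 Hp) as [ce [Hce _]].
  assert (Ece : forall n, c (S n) = (ce (S n) * n_pow_opp (S n) (RtoC (1 - eps)))%C).
  { apply (dirichlet_coef_unique c (fun n => ce n * n_pow_opp n (RtoC (1 - eps)))%C _ Hc).
    eapply is_dirichlet_series_ext; [| |exact (dirichlet_shift ce _ (1 - eps) H1 Hce)].
    - easy.
    - intros t; simpl; f_equal; apply C0_eq; simpl.
      rewrite RtoC_minus; ring. }
  assert (Hpt : 0 < Re (proj1_sig s - RtoC eps)).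
  { unfold Cminus; rewrite <- RtoC_opp, Re_plus_R; lra. }
  pose proof (Hce (exist _ _ Hpt)) as Hlim.
  cbv beta in Hlim; cbn [proj1_sig] in Hlim.
  replace (shift eps H0 (exist _ _ Hpt)) with s in Hlim by (apply C0_eq; simpl; ring).
  eapply is_series_ext; [|exact Hlim].
  intros n; cbn [proj1_sig]; rewrite Ece.
  replace (proj1_sig s - RtoC eps)%C
    with (RtoC (1 - eps) + (RtoC (-1) + proj1_sig s))%C.
  + rewrite !n_pow_opp_plus; match goal with |- ?x = ?y => change (@eq C x y) end; ring.
  + rewrite RtoC_minus; change (RtoC (-1)) with (RtoC (- (1))); rewrite RtoC_opp; ring.
- intros s; unfold fun_mult; rewrite Cmod_mult.
  apply Rmult_le_compat; try apply Cmod_ge_0; easy.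
- intros n Hn HXn; rewrite HXc by easy; ring.
Qed.

Lemma subsemigroup_iff_subalgebra (X : nat -> Prop) :
  (forall n, X n -> (1 <= n)%nat) ->
  (multiplicative_subsemigroup X <-> is_subalgebra (HinfS X) Hinf).
Proof.
intros HX1; split.
- intros HX; split; [|split; [|split]].
  + now intros f [Hf _].
  + apply HinfS_plus.
  + intros c f; apply HinfS_scal.
  + intros f g; now apply HinfS_mult.
- intros [_ [_ [_ Hmult]]] m n Hm Hn; apply NNPP; intros Hmn.
  assert (Hm1 := HX1 m Hm); assert (Hn1 := HX1 n Hn).
  assert (Hmn1 : (1 <= m * n)%nat) by nia.
  destruct (Hmult _ _ (HinfS_monomial X m Hm1 Hm) (HinfS_monomial X n Hn1 Hn)) as [_ [a [Ha Ha0]]].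
  assert (Hd : is_dirichlet_series (fun k => if Nat.eqb k (m * n) then RtoC 1 else RtoC 0)
    (fun_mult (monomial m) (monomial n))).
  { eapply is_dirichlet_series_ext; [| |exact (monomial_dirichlet (m * n) Hmn1)]; [easy|].
    intros s; now apply monomial_mult. }
  destruct (Nat.lt_exists_pred 0 (m * n) ltac:(lia)) as [q [Eq _]].
  (* At index [m * n] the coefficient would be 0 by the support condition and 1 by uniqueness. *)
  pose proof (dirichlet_coef_unique _ _ _ Ha Hd q) as E; rewrite <- Eq in E.
  rewrite Nat.eqb_refl, (Ha0 (m * n)%nat Hmn1 Hmn) in E.
  apply (f_equal fst) in E; simpl in E; lra.
Qed.

(** * The Banach algebra *)

Definition hs_type (X : nat -> Prop) : Type := {f : C0 -> C | HinfS X f}.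

Definition hs_fun (X : nat -> Prop) (x : hs_type X) : C0 -> C := proj1_sig x.

Lemma hs_eq (X : nat -> Prop) (x y : hs_type X) :
  (forall s, hs_fun X x s = hs_fun X y s) -> x = y.
Proof.
destruct x as [f Hf], y as [g Hg]; unfold hs_fun; simpl; intros H.
apply functional_extensionality in H; subst g; f_equal; apply proof_irrelevance.
Qed.

Definition hs_plus (X : nat -> Prop) (x y : hs_type X) : hs_type X :=
  exist _ (fun_plus (proj1_sig x) (proj1_sig y))
    (HinfS_plus X _ _ (proj2_sig x) (proj2_sig y)).

Definition hs_scal (X : nat -> Prop) (c : C) (x : hs_type X) : hs_type X :=
  exist _ (fun_scal c (proj1_sig x)) (HinfS_scal X c _ (proj2_sig x)).

Definition hs_zero (X : nat -> Prop) : hs_type X := exist _ _ (HinfS_zero X).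

(** [real] sends infinite values to 0; [hs_norm_finite] excludes that case. *)
Definition hs_norm (X : nat -> Prop) (x : hs_type X) : R := real (sup_norm (hs_fun X x)).

(** The point 1 makes the supremum run over a nonempty set, which rules out [m_infty]; membership in
    [Hinf] rules out [p_infty]. *)
Lemma hs_norm_finite (X : nat -> Prop) (x : hs_type X) :
  Finite (hs_norm X x) = sup_norm (hs_fun X x).
Proof.
assert (Hx := proj2 (proj1 (proj2_sig x))).
assert (H1 : 0 < Re (1, 0)) by (simpl; lra).
pose proof (proj1 (sup_norm_is_lub (hs_fun X x)) _ (ex_intro _ (exist _ (1, 0) H1) eq_refl)) as H.
unfold hs_norm; fold (hs_fun X x) in Hx.
destruct (sup_norm (hs_fun X x)); simpl in *; easy.
Qed.

Lemma hs_norm_ge (X : nat -> Prop) (x : hs_type X) (s : C0) :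
  Cmod (hs_fun X x s) <= hs_norm X x.
Proof.
pose proof (proj1 (sup_norm_is_lub (hs_fun X x)) _ (ex_intro _ s eq_refl)) as H.
now rewrite <- hs_norm_finite in H.
Qed.

Lemma hs_norm_le (X : nat -> Prop) (x : hs_type X) (B : R) :
  bounded_by B (hs_fun X x) -> hs_norm X x <= B.
Proof.
intros HB.
assert (H : Rbar_le (sup_norm (hs_fun X x)) (Finite B)).
{ apply (sup_norm_is_lub (hs_fun X x)); intros r [s ->]; apply HB. }
now rewrite <- hs_norm_finite in H.
Qed.

(** * The complete normed module structure *)

Definition hs_AbelianMonoid_mixin (X : nat -> Prop) : AbelianMonoid.mixin_of (hs_type X).
Proof.
apply (AbelianMonoid.Mixin _ (hs_plus X) (hs_zero X)).
- intros x y; apply hs_eq; intros s; apply Cplus_comm.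
- intros x y z; apply hs_eq; intros s; apply Cplus_assoc.
- intros x; apply hs_eq; intros s; apply Cplus_0_r.
Defined.

Definition hs_AbelianMonoid (X : nat -> Prop) : AbelianMonoid :=
  AbelianMonoid.Pack _ (hs_AbelianMonoid_mixin X) (hs_type X).

Definition hs_AbelianGroup_mixin (X : nat -> Prop) : AbelianGroup.mixin_of (hs_AbelianMonoid X).
Proof.
apply (AbelianGroup.Mixin (hs_AbelianMonoid X) (hs_scal X (- (1))%C)).
intros x; apply hs_eq; intros s; unfold hs_fun; simpl; unfold fun_plus, fun_scal; ring.
Defined.

Definition hs_AbelianGroup (X : nat -> Prop) : AbelianGroup :=
  AbelianGroup.Pack _ (AbelianGroup.Class _ _ (hs_AbelianGroup_mixin X)) (hs_type X).

Definition hs_ModuleSpace_mixin (X : nat -> Prop) :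
  ModuleSpace.mixin_of C_Ring (hs_AbelianGroup X).
Proof.
apply (ModuleSpace.Mixin C_Ring (hs_AbelianGroup X) (hs_scal X)).
- intros a b x; apply hs_eq; intros s; apply Cmult_assoc.
- intros x; apply hs_eq; intros s; apply Cmult_1_l.
- intros a x y; apply hs_eq; intros s; apply Cmult_plus_distr_l.
- intros a b x; apply hs_eq; intros s; apply Cmult_plus_distr_r.
Defined.

Lemma hs_norm_plus (X : nat -> Prop) (x y : hs_type X) :
  hs_norm X (hs_plus X x y) <= hs_norm X x + hs_norm X y.
Proof.
apply hs_norm_le; intros s; eapply Rle_trans; [apply Cmod_triangle|].
apply Rplus_le_compat; apply hs_norm_ge.
Qed.

Lemma hs_norm_scal (X : nat -> Prop) (c : C) (x : hs_type X) :
  hs_norm X (hs_scal X c x) <= Cmod c * hs_norm X x.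
Proof.
apply hs_norm_le; intros s; unfold hs_fun; simpl; unfold fun_scal; rewrite Cmod_mult.
apply Rmult_le_compat_l; [apply Cmod_ge_0|apply hs_norm_ge].
Qed.

(** Convertible with [minus] of the group structure, so the axioms comparing balls with the norm
    hold by the definition of [hs_ball]. *)
Definition hs_minus (X : nat -> Prop) (x y : hs_type X) : hs_type X :=
  hs_plus X x (hs_scal X (- (1))%C y).

Lemma hs_minus_fun (X : nat -> Prop) (x y : hs_type X) (s : C0) :
  hs_fun X (hs_minus X x y) s = (hs_fun X x s - hs_fun X y s)%C.
Proof. unfold hs_fun; simpl; unfold fun_plus, fun_scal; ring. Qed.

Definition hs_ball (X : nat -> Prop) (x : hs_type X) (e : R) (y : hs_type X) : Prop :=
  hs_norm X (hs_minus X y x) < e.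

Definition hs_UniformSpace_mixin (X : nat -> Prop) : UniformSpace.mixin_of (hs_type X).
Proof.
apply (UniformSpace.Mixin _ (hs_zero X) (hs_ball X)).
- intros x e; eapply Rle_lt_trans; [apply (hs_norm_le _ _ 0)|apply cond_pos].
  intros s; rewrite hs_minus_fun.
  replace (hs_fun X x s - hs_fun X x s)%C with (RtoC 0) by ring; rewrite Cmod_0; lra.
- intros x y e H; eapply Rle_lt_trans; [|exact H].
  apply hs_norm_le; intros s; rewrite hs_minus_fun, Cmod_minus_sym, <- hs_minus_fun.
  apply hs_norm_ge.
- intros x y z e1 e2 H1 H2; unfold hs_ball in *.
  apply Rle_lt_trans with (hs_norm X (hs_minus X y x) + hs_norm X (hs_minus X z y)); [|lra].
  apply hs_norm_le; intros s; rewrite hs_minus_fun.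
  replace (hs_fun X z s - hs_fun X x s)%C with
    (hs_fun X (hs_minus X y x) s + hs_fun X (hs_minus X z y) s)%C
    by (rewrite !hs_minus_fun; ring).
  eapply Rle_trans; [apply Cmod_triangle|]; apply Rplus_le_compat; apply hs_norm_ge.
Defined.

Definition hs_UniformSpace (X : nat -> Prop) : UniformSpace :=
  UniformSpace.Pack _ (hs_UniformSpace_mixin X) (hs_type X).

Definition hs_NormedModuleAux_class (X : nat -> Prop) :
  NormedModuleAux.class_of C_AbsRing (hs_type X) :=
  NormedModuleAux.Class C_AbsRing (hs_type X)
    (ModuleSpace.Class C_Ring (hs_type X) (AbelianGroup.Class _ _ (hs_AbelianGroup_mixin X))
      (hs_ModuleSpace_mixin X))
    (hs_UniformSpace_mixin X).

Definition hs_NormedModuleAux (X : nat -> Prop) : NormedModuleAux C_AbsRing :=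
  NormedModuleAux.Pack C_AbsRing (hs_type X) (hs_NormedModuleAux_class X) (hs_type X).

Definition hs_NormedModule_mixin (X : nat -> Prop) :
  NormedModule.mixin_of C_AbsRing (hs_NormedModuleAux X).
Proof.
apply (NormedModule.Mixin C_AbsRing (hs_NormedModuleAux X) (hs_norm X) 1).
- apply hs_norm_plus.
- apply hs_norm_scal.
- intros x y e H; exact H.
- intros x y e H; rewrite Rmult_1_l; exact H.
- intros x H; apply hs_eq; intros s; apply Cmod_eq_0, Rle_antisym; [|apply Cmod_ge_0].
  rewrite <- H; apply hs_norm_ge.
Defined.

(** A Cauchy filter contains a ball of radius [1 / (n + 1)] for each [n]. Any two of these meet, so
    their centres form a sequence that is uniformly Cauchy with an explicit rate; its pointwise
    limit is uniform and stays in [HinfS X]. *)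
Lemma hs_complete (X : nat -> Prop) (F : (hs_UniformSpace X -> Prop) -> Prop) :
  ProperFilter F -> cauchy F ->
  exists x : hs_UniformSpace X, forall eps : posreal, F (ball x eps).
Proof.
intros HF HC.
assert (Hseq : forall n, exists x : hs_UniformSpace X, F (ball x (/ INR (S n)))).
{ intros n; exact (HC (mkposreal _ (Rinv_0_lt_compat _ (INR_S_pos n)))). }
set (x := fun n => proj1_sig (constructive_indefinite_description _ (Hseq n))).
assert (Hx : forall n, F (ball (x n) (/ INR (S n)))).
{ intros n; exact (proj2_sig (constructive_indefinite_description _ (Hseq n))). }
clearbody x; clear Hseq.
assert (Hxx : forall s n k, Cmod (hs_fun X (x n) s - hs_fun X (x k) s)
  <= 1 * (/ INR (S n) + / INR (S k))).
{ intros s n k.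
  destruct (filter_ex _ (filter_and _ _ (Hx n) (Hx k))) as [y [H1 H2]].
  change (hs_ball X (x n) (/ INR (S n)) y) in H1.
  change (hs_ball X (x k) (/ INR (S k)) y) in H2; unfold hs_ball in H1, H2.
  replace (hs_fun X (x n) s - hs_fun X (x k) s)%C with
    (- hs_fun X (hs_minus X y (x n)) s + hs_fun X (hs_minus X y (x k)) s)%C
    by (rewrite !hs_minus_fun; ring).
  eapply Rle_trans; [apply Cmod_triangle|]; rewrite Cmod_opp.
  pose proof (hs_norm_ge X (hs_minus X y (x n)) s).
  pose proof (hs_norm_ge X (hs_minus X y (x k)) s); lra. }
assert (Hlim : forall s, exists l, forall n, Cmod (hs_fun X (x n) s - l) <= 1 / INR (S n)).
{ intros s; apply C_cauchy_limit; apply Hxx. }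
set (f := fun s => proj1_sig (constructive_indefinite_description _ (Hlim s))).
assert (Hf : forall s n, Cmod (hs_fun X (x n) s - f s) <= 1 / INR (S n)).
{ intros s; exact (proj2_sig (constructive_indefinite_description _ (Hlim s))). }
clearbody f; clear Hlim.
assert (Hsmall : forall e, 0 < e -> exists n, 2 * / INR (S n) < e).
{ intros e He; destruct (INR_unbounded (2 / e)) as [n Hn]; exists n.
  apply Rmult_lt_reg_r with (INR (S n)); [apply INR_S_pos|].
  rewrite Rmult_assoc, Rinv_l by (pose proof (INR_S_pos n); lra).
  rewrite S_INR; assert (2 = e * (2 / e)) by (field; lra); nra. }
assert (HfX : HinfS X f).
{ apply HinfS_uniform_limit; intros e He.
  destruct (Hsmall e He) as [n Hn]; exists (hs_fun X (x n)); split.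
  - exact (proj2_sig (x n)).
  - intros s; rewrite Cmod_minus_sym; specialize (Hf s n).
    assert (0 < / INR (S n)) by apply Rinv_0_lt_compat, INR_S_pos; lra. }
exists (exist _ f HfX : hs_type X); intros eps.
destruct (Hsmall eps (cond_pos eps)) as [n Hn].
eapply filter_imp; [|exact (Hx n)]; intros y Hy.
change (hs_ball X (x n) (/ INR (S n)) y) in Hy; unfold hs_ball in Hy.
eapply Rle_lt_trans; [apply (hs_norm_le _ _ (2 * / INR (S n)))|exact Hn].
intros s; rewrite hs_minus_fun; unfold hs_fun at 2; simpl proj1_sig.
replace (hs_fun X y s - f s)%C with
  (hs_fun X (hs_minus X y (x n)) s + (hs_fun X (x n) s - f s))%C
  by (rewrite hs_minus_fun; ring).
eapply Rle_trans; [apply Cmod_triangle|].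
pose proof (hs_norm_ge X (hs_minus X y (x n)) s); specialize (Hf s n); lra.
Qed.

(** The structure asks for a limit operator on all filters, so the limit is chosen by [epsilon],
    with an arbitrary value where none exists. Equivalent filters are equal by extensionality and
    thus receive the same choice. *)
Definition hs_CompleteSpace_mixin (X : nat -> Prop) : CompleteSpace.mixin_of (hs_UniformSpace X).
Proof.
apply (CompleteSpace.Mixin (hs_UniformSpace X)
  (fun F => epsilon (inhabits (hs_zero X : hs_UniformSpace X))
    (fun x : hs_UniformSpace X => forall eps : posreal, F (ball x eps)))).
- intros F HF HC; apply epsilon_spec; exact (hs_complete X F HF HC).
- intros F G HFG HGF.
  assert (E : F = G).
  { apply functional_extensionality; intros P; apply propositional_extensionality.
    split; [apply HGF|apply HFG]. }
  rewrite E; apply close_refl.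
Defined.

Definition hs_CompleteNormedModule (X : nat -> Prop) : CompleteNormedModule C_AbsRing :=
  CompleteNormedModule.Pack C_AbsRing (hs_type X)
    (CompleteNormedModule.Class C_AbsRing (hs_type X)
      (NormedModule.Class C_AbsRing (hs_type X) (hs_NormedModuleAux_class X)
        (hs_NormedModule_mixin X))
      (hs_CompleteSpace_mixin X))
    (hs_type X).

Definition hs_mult (X : nat -> Prop) (H : is_subalgebra (HinfS X) Hinf) (x y : hs_type X) :
  hs_type X :=
  exist _ (fun_mult (proj1_sig x) (proj1_sig y))
    (proj2 (proj2 (proj2 H)) _ _ (proj2_sig x) (proj2_sig y)).

Definition hs_BanachAlgebra (X : nat -> Prop) (H : is_subalgebra (HinfS X) Hinf) : BanachAlgebra.
Proof.
apply (Build_BanachAlgebra (hs_CompleteNormedModule X) (hs_mult X H)).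
- intros x y z; apply hs_eq; intros s; apply Cmult_assoc.
- intros x y z; apply hs_eq; intros s; apply Cmult_plus_distr_r.
- intros x y z; apply hs_eq; intros s; apply Cmult_plus_distr_l.
- intros c x y; apply hs_eq; intros s; symmetry; apply Cmult_assoc.
- intros c x y; apply hs_eq; intros s.
  unfold hs_fun; simpl; unfold fun_mult, fun_scal; ring.
- intros x y; apply hs_norm_le; intros s.
  unfold hs_fun; simpl; unfold fun_mult; rewrite Cmod_mult.
  apply Rmult_le_compat; try apply Cmod_ge_0; apply hs_norm_ge.
Defined.

(** [hs_CompleteNormedModule] is available for any [X], so stability under products is all that the
    first direction has to draw from the subalgebra. Conversely, the image of [iota] is closed
    because the operations of [B] are carried to the pointwise ones. *)
Lemma subalgebra_iff_banach_algebra (X : nat -> Prop) :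
  is_subalgebra (HinfS X) Hinf <-> is_sup_norm_banach_algebra (HinfS X).
Proof.
split.
- intros H; exists (hs_BanachAlgebra X H), (hs_fun X).
  split; [|split; [|split; [|split; [|split]]]]; try reflexivity.
  + intros x y E; apply hs_eq; intros s; now rewrite E.
  + intros f; split.
    * intros Hf; now exists (exist _ f Hf).
    * intros [x <-]; exact (proj2_sig x).
  + apply hs_norm_finite.
- intros [B [iota [_ [Hiff [Hplus [Hscal [Hmult _]]]]]]].
  split; [|split; [|split]].
  + now intros f [Hf _].
  + intros f g Hf Hg.
    apply Hiff in Hf, Hg; destruct Hf as [x <-], Hg as [y <-].
    apply Hiff; now exists (plus x y).
  + intros c f Hf; apply Hiff in Hf; destruct Hf as [x <-].
    apply Hiff; now exists (scal c x).
  + intros f g Hf Hg.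
    apply Hiff in Hf, Hg; destruct Hf as [x <-], Hg as [y <-].
    apply Hiff; now exists (ba_mult B x y).
Qed.

Theorem proposition2p1 (S : nat -> Prop) (HS : forall n : nat, S n -> (1 <= n)%nat) :
  (multiplicative_subsemigroup S <-> is_subalgebra (HinfS S) Hinf) /\
  (is_subalgebra (HinfS S) Hinf <-> is_sup_norm_banach_algebra (HinfS S)).
Proof.
split.
- now apply subsemigroup_iff_subalgebra.
- apply subalgebra_iff_banach_algebra.
Qed.
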